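(* The variance of the multiplicity of the eigenvalue $0$ of the random recursive tree $\mathcal{R}_n$ with $n$ vertices satisfies, as $n\to\infty$, \[\mathbb{V}(N_0(\mathcal{R}_n)) = K_1 n + \mathcal{O}\Big(\frac{n}{\log n}\Big),\] where $K_1$ is the (convergent) integral \[K_1 = \int_0^1 \Big( \frac{(2A(u)-1)^2}{(1-u)^2} + \frac{4G_{-}(u)}{1-\log(1-u)} - \frac{(2G-1)^2}{(1-u)^2} \Big)\,du,\] with the constant $G$ and the functions $A$ and $G_-$ as defined in the context.
   Context: A recursive tree with $n$ vertices is a rooted (unordered) tree with vertex labels $1,\dots,n$, each used once, whose labels increase along every path starting at the root. There are $(n-1)!$ of them, and the random recursive tree $\mathcal{R}_n$ is uniformly distributed among them. $N_0(T)$ is the multiplicity of $0$ as an eigenvalue of the adjacency matrix of the underlying undirected graph of $T$. $\mathbb{V}$ denotes variance. For $0\le x<1$ define \[A(x)=\int_0^x \frac{1}{1-\log(1-u)}\,du,\] and let $G=A(1)=\int_0^1\frac{1}{1-\log(1-u)}\,du$ (the Euler–Gompertz constant). For $0\le x<1$ define \[G_{-}(x) = -\frac{(2A(x)-1)\log(1-x)}{(1-x)(1-\log(1-x))} + \frac{\log(1-x) + 2\log(1-\log(1-x))}{1-\log(1-x)}.\] *)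

(* Defs.v *)
From HB Require Import structures.
From mathcomp Require Import all_boot all_order all_algebra.
From mathcomp Require Import all_classical all_reals all_analysis.

Set Implicit Arguments.
Unset Strict Implicit.
Unset Printing Implicit Defensive.

Import Order.TTheory GRing.Theory Num.Theory.
Import numFieldNormedType.Exports.

Local Open Scope classical_set_scope.
Local Open Scope ring_scope.

(* A rooted labelled graph is a root together with a set of ordered pairs of
   adjacent vertices; the vertex i : 'I_n carries the label i + 1. *)
Definition rgraph (n : nat) : finType := ('I_n * {set 'I_n * 'I_n})%type.

Definition root_of n (t : rgraph n) : 'I_n := t.1.

Definition adj n (t : rgraph n) : rel 'I_n := fun x y => (x, y) \in t.2.

(* With e symmetric, every edge x -- y is a ucycle [:: x; y] of size 2, so
   acyclicity only excludes longer ones. *)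
Definition is_tree n (e : rel 'I_n) : Prop :=
  [/\ symmetric e, irreflexive e,
      forall x y, connect e x y &
      forall c : seq 'I_n, ucycle e c -> (size c <= 2)%N].

Definition increasing_from n (e : rel 'I_n) (r : 'I_n) : Prop :=
  forall p : seq 'I_n, path e r p -> uniq (r :: p) ->
    path (fun x y : 'I_n => (x < y)%N) r p.

Definition is_recursive_tree n (t : rgraph n) : Prop :=
  is_tree (adj t) /\ increasing_from (adj t) (root_of t).

Definition recursive_trees (n : nat) : {set rgraph n} :=
  [set t : rgraph n | `[< is_recursive_tree t >]]%SET.

Definition adjmx (R : realType) n (t : rgraph n) : 'M[R]_n :=
  \matrix_(i, j) (adj t i j)%:R.

Definition N0 (R : realType) n (t : rgraph n) : nat :=
  mup 0 (char_poly (adjmx R t)).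

Section uniform.
Variables (R : realType) (T : finType) (S : {set T}).

(* Mean and variance of f(X) for X uniformly distributed on S. *)
Definition unif_mean (f : T -> R) : R := (\sum_(t in S) f t) / #|S|%:R.

Definition unif_var (f : T -> R) : R :=
  unif_mean (fun t => (f t - unif_mean f) ^+ 2).
End uniform.

Definition var_N0 (R : realType) (n : nat) : R :=
  unif_var (recursive_trees n) (fun t => (N0 R t)%:R).

(* At x = 1 the integrand takes the junk value (1 - ln 0)^-1 = 1 on the null
   set {1}, so A 1 is the integral over [0, 1). *)
Definition A (R : realType) (x : R) : R :=
  \int[lebesgue_measure]_(u in `[0, x]) (1 - ln (1 - u))^-1.

Definition Gompertz (R : realType) : R := A 1.

Definition Gminus (R : realType) (x : R) : R :=
  - ((2 * A x - 1) * ln (1 - x) / ((1 - x) * (1 - ln (1 - x))))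
  + (ln (1 - x) + 2 * ln (1 - ln (1 - x))) / (1 - ln (1 - x)).

Definition K1_integrand (R : realType) (u : R) : R :=
  (2 * A u - 1) ^+ 2 / (1 - u) ^+ 2
  + 4 * Gminus u / (1 - ln (1 - u))
  - (2 * Gompertz R - 1) ^+ 2 / (1 - u) ^+ 2.

Definition K1 (R : realType) : R :=
  \int[lebesgue_measure]_(u in `[0, 1[) K1_integrand u.

(* Main.v *)
(* Cutting the edge between the vertices labelled 1 and 2 splits a random
   recursive tree into two independent ones. Calling a rooted tree free when
   some maximum matching misses its root, N_0 of the tree is the sum over the
   two parts, minus 2 when both are free. This gives quadratic recurrences for
   the probability of being free and for the first two moments of
   N_0(R_n) - c n. With c the limit of E N_0(R_n) / n, the centred mean and its
   restriction to free trees stay bounded, so the recurrence of the second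
   moment forces it to be K n + O(1).

   On the side of generating functions the recurrences become linear
   differential equations on [0, 1) with explicit solutions, which yield
   c = 2 G - 1 and a function with derivative the integrand of K_1; the
   Abelian theorem evaluates its limit at 1, whence K = K_1. The integrand is
   bounded above, so the existence of this limit also gives its integrability. *)

Require Import Defs.
From HB Require Import structures.
From mathcomp Require Import all_boot all_order all_algebra.
From mathcomp Require Import all_classical all_reals all_analysis.
From mathcomp Require Import measurable_realfun.
From mathcomp Require Import ring lra zify.
Import Order.TTheory GRing.Theory Num.Theory.
Import numFieldNormedType.Exports.
Local Open Scope classical_set_scope.
Local Open Scope ring_scope.

Set Implicit Arguments.
Unset Strict Implicit.
Unset Printing Implicit Defensive.

(** Expectations are taken over unlabelled binary shapes grown leaf by leaf, because a labelled tree
    enters only through its shape; a bijection with parent sequences recovers the actual graphs and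
    their number.

    The link with the adjacency matrix is elimination at small positive [x]: a pivot behaves like a
    multiple of [x] or of [1/x] according to freeness, and the signs of the leading coefficients
    exclude cancellation.

    Existence precedes evaluation. The constants [c] and [K] are produced by nested intervals,
    without a formula; they are identified only at the end, by letting [x] tend to 1 in exact
    identities between generating functions. Solutions of the differential equations are checked,
    not derived: a difference with derivative 0 on [0, 1) vanishes because it does so at 0.

    Two summands of the integrand of $K_1$ are singular like $(1-u)^{-2}$ at 1 and only their
    combination is integrable, which is why a primitive of the whole integrand is used. The
    elementary route gives an error O(1), which is below n / log n. *)

(** * Shapes of recursive trees and the splitting recurrence *)

(* [Join t1 t2] is the recursive tree in which the vertex labelled 2 carries the
   subtree [t1] and [t2] is what remains, so its root is that of [t2]. *)
Inductive shape : Type := Leaf | Join of shape & shape.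

Fixpoint order (t : shape) : nat :=
  match t with Leaf => 1%N | Join t1 t2 => (order t1 + order t2)%N end.

(* One way of attaching a new leaf for each vertex of [t]. *)
Fixpoint ins (t : shape) : seq shape :=
  match t with
  | Leaf => [:: Join Leaf Leaf]
  | Join t1 t2 => [seq Join t t2 | t <- ins t1] ++ [seq Join t1 t | t <- ins t2]
  end.

(* Some maximum matching misses the root, that is, no child of the root is free. *)
Fixpoint free (t : shape) : bool :=
  match t with Leaf => true | Join t1 t2 => free t2 && ~~ free t1 end.

(** The nullity of a tree is its order minus twice the size of a maximum matching, and the edge
    between the two roots enlarges that matching exactly when both roots can be missed. Integers
    keep the subtraction exact before nonnegativity is known. *)
Fixpoint nul (t : shape) : int :=
  match t with
  | Leaf => 1
  | Join t1 t2 => nul t1 + nul t2 - (2 * (free t1 && free t2))%N%:Z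
  end.

(** A list with repetitions: a shape occurs once for each recursive tree on [m + 1] vertices that
    has it, so averaging over the list is averaging over trees. *)
Fixpoint shapes (m : nat) : seq shape :=
  if m is k.+1 then flatten [seq ins t | t <- shapes k] else [:: Leaf].

Lemma size_ins t : size (ins t) = order t.
Proof. by elim: t => //= t1 h1 t2 h2; rewrite size_cat !size_map h1 h2. Qed.

(** * Expectations over random shapes and the splitting identity *)

Section expectation.
Variable R : realFieldType.
Implicit Types f g : shape -> R.

Definition E m f : R := (\sum_(t <- shapes m) f t) / m`!%:R.

Lemma sum_ins (f : shape -> R) t1 t2 :
  \sum_(t <- ins (Join t1 t2)) f t =
  \sum_(t <- ins t1) f (Join t t2) + \sum_(t <- ins t2) f (Join t1 t).
Proof. by rewrite /= big_cat !big_map. Qed.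

Lemma E0 f : E 0 f = f Leaf.
Proof. by rewrite /E /= big_seq1 divr1. Qed.

Lemma ES m f : E m.+1 f = E m (fun t => \sum_(s <- ins t) f s) / m.+1%:R.
Proof.
rewrite /E /= big_flatten big_map factS natrM invfM.
by rewrite mulrA mulrAC.
Qed.

Lemma eq_E m f g : f =1 g -> E m f = E m g.
Proof. by move=> fg; rewrite /E (eq_bigr _ (fun t _ => fg t)). Qed.

Lemma E_D m f g : E m (fun t => f t + g t) = E m f + E m g.
Proof. by rewrite /E big_split /= mulrDl. Qed.

Lemma E_N m f : E m (fun t => - f t) = - E m f.
Proof. by rewrite /E sumrN mulNr. Qed.

Lemma E_B m f g : E m (fun t => f t - g t) = E m f - E m g.
Proof. by rewrite E_D E_N. Qed.

Lemma E_Z m a f : E m (fun t => a * f t) = a * E m f.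
Proof. by rewrite /E -mulr_sumr mulrA. Qed.

Lemma E_Zr m a f : E m (fun t => f t * a) = E m f * a.
Proof. by rewrite mulrC -E_Z; apply: eq_E => t; rewrite mulrC. Qed.

(** Each insertion adds one vertex. Keeping the order as a separate argument of [F] lets the
    induction shift it without reasoning about membership in [shapes m]. *)
Lemma E_order m (F : nat -> shape -> R) :
  E m (fun t => F (order t) t) = E m (fun t => F m.+1 t).
Proof.
elim: m F => [|m IH] F; first by rewrite !E0.
rewrite !ES; congr (_ / _).
rewrite (IH (fun n t => \sum_(s <- ins t) F (order s) s)).
rewrite (IH (fun n t => \sum_(s <- ins t) F m.+2 s)).
pose H n t := \sum_(s <- ins t) F n.+1 s.
rewrite -[RHS](IH (fun n t => H n t)) -(IH (fun n t => \sum_(s <- ins t) F (order s) s)).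
apply: eq_E => t; rewrite /H.
elim: t F {IH H} => [|t1 h1 t2 h2] F; first by rewrite !big_seq1.
rewrite !sum_ins.
rewrite (h1 (fun n s => F (n + order t2)%N (Join s t2))).
rewrite (h2 (fun n s => F (order t1 + n)%N (Join t1 s))) /=.
by rewrite addnS addSn.
Qed.

Lemma E_cst m a : E m (fun=> a) = a.
Proof.
elim: m a => [|m IH] a; first by rewrite E0.
rewrite ES (@eq_E _ _ (fun t => (order t)%:R * a)); last first.
  by move=> t; rewrite big_const_seq count_predT size_ins iter_addr_0 mulr_natl.
rewrite (E_order m (fun n _ => n%:R * a)) E_Z IH mulrAC.
by rewrite divff ?mul1r ?pnatr_eq0.
Qed.

Lemma E_sum m (I : Type) (r : seq I) (F : I -> shape -> R) :
  E m (fun t => \sum_(k <- r) F k t) = \sum_(k <- r) E m (F k).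
Proof. by rewrite /E exchange_big /= mulr_suml. Qed.

Lemma ge0_E m f : (forall t, 0 <= f t) -> 0 <= E m f.
Proof. by move=> f0; rewrite divr_ge0 ?ler0n ?sumr_ge0. Qed.

Lemma le_E m f g : (forall t, f t <= g t) -> E m f <= E m g.
Proof. by move=> fg; rewrite -subr_ge0 -E_B ge0_E // => t; rewrite subr_ge0. Qed.

(** The part hanging from vertex 2 has uniformly distributed size, and given the sizes both parts
    are independent and again uniform. This is a Pólya urn: a new leaf joins a part with probability
    proportional to its order. *)
Lemma split_E m f :
  m.+1%:R * E m.+1 f =
  \sum_(k < m.+1) E k (fun t1 => E (m - k)%N (fun t2 => f (Join t1 t2))).
Proof.
elim: m f => [|m IH] f.
  by rewrite big_ord1 ES !E0 /= big_seq1 divr1 mul1r.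
rewrite ES mulrCA divff ?mulr1; last by rewrite pnatr_eq0.
apply: (@mulfI _ m.+1%:R); first by rewrite pnatr_eq0.
rewrite IH.
pose e k := E k (fun t1 => E (m.+1 - k)%N (fun t2 => f (Join t1 t2))).
(* The left part offers [k + 1] places for the new leaf and the right one [m - k + 1]. After the
   shift of index below, [e k] collects the weight [k + (m + 1 - k) = m + 1], independent of [k]. *)
have Ek k : (k < m.+1)%N ->
   E k (fun t1 => E (m - k)%N (fun t2 => \sum_(s <- ins (Join t1 t2)) f s)) =
   k.+1%:R * e k.+1 + (m.+1 - k)%:R * e k.
  move=> km.
  rewrite (@eq_E _ _ (fun t1 => \sum_(s <- ins t1) E (m - k)%N (fun t2 => f (Join s t2))
      + (m.+1 - k)%:R * E (m.+1 - k)%N (fun t2 => f (Join t1 t2)))).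
    rewrite E_D E_Z /e ES subSS; congr (_ + _).
    by rewrite mulrCA divff ?mulr1 ?pnatr_eq0.
  move=> t1; rewrite -E_sum subSn // ES mulrCA divff ?pnatr_eq0 // mulr1 -E_D.
  by apply: eq_E => t2; rewrite sum_ins.
under eq_bigr => k _ do rewrite (Ek k (ltn_ord k)).
rewrite big_split /= mulr_sumr -/(e _).
under [RHS]eq_bigr => k _ do rewrite -/(e k).
rewrite [X in X + _](_ : _ = \sum_(k < m.+2) k%:R * e k); last first.
  by rewrite [RHS]big_ord_recl /= mul0r add0r.
rewrite [X in _ + X](_ : _ = \sum_(k < m.+2) (m.+1 - k)%:R * e k); last first.
  by rewrite [RHS]big_ord_recr /= subnn mul0r addr0.
rewrite -big_split /=; apply: eq_bigr => k _.
by rewrite -mulrDl -natrD subnKC // -ltnS.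
Qed.
End expectation.

Definition conv (R : pzRingType) (a b : nat -> R) (m : nat) : R :=
  \sum_(k < m.+1) a k * b (m - k)%N.

Lemma convC (R : comPzRingType) (a b : nat -> R) m : conv a b m = conv b a m.
Proof.
rewrite /conv (reindex_inj rev_ord_inj) /=; apply: eq_bigr => k _.
have km : (k <= m)%N by rewrite -ltnS.
by rewrite subSS subKn // mulrC.
Qed.

Lemma sum_rev (V : zmodType) (a : nat -> V) m :
  \sum_(k < m.+1) a (m - k)%N = \sum_(k < m.+1) a k.
Proof.
rewrite (reindex_inj rev_ord_inj) /=; apply: eq_bigr => k _.
by rewrite subSS subKn // -ltnS.
Qed.

Section pair_expectation.
Variable R : realFieldType.
Implicit Types h : shape -> shape -> R.

Definition EE k n h := E k (fun t1 => E n (h t1)).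

Lemma eq_EE k n h h' : (forall t1 t2, h t1 t2 = h' t1 t2) -> EE k n h = EE k n h'.
Proof. by move=> hh; apply: eq_E => t1; apply: eq_E. Qed.

Lemma EE_D k n h h' :
  EE k n (fun t1 t2 => h t1 t2 + h' t1 t2) = EE k n h + EE k n h'.
Proof. by rewrite /EE -E_D; apply: eq_E => t1; rewrite E_D. Qed.

Lemma EE_Z k n a h : EE k n (fun t1 t2 => a * h t1 t2) = a * EE k n h.
Proof. by rewrite /EE -E_Z; apply: eq_E => t1; rewrite E_Z. Qed.

Lemma EE_M k n (f g : shape -> R) :
  EE k n (fun t1 t2 => f t1 * g t2) = E k f * E n g.
Proof. by rewrite -E_Zr; apply: eq_E => t1; rewrite E_Z. Qed.

Lemma EE_l k n (f : shape -> R) : EE k n (fun t1 _ => f t1) = E k f.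
Proof. by apply: eq_E => t1; rewrite E_cst. Qed.

Lemma EE_r k n (f : shape -> R) : EE k n (fun _ t2 => f t2) = E n f.
Proof. exact: E_cst. Qed.

End pair_expectation.

(** * Recurrences for an additive functional corrected at the splitting edge *)

Section join_recurrences.
Variables (R : realFieldType) (F Y : shape -> R).
Hypothesis FF : forall t, F t * F t = F t.
Hypothesis F_Join : forall t1 t2, F (Join t1 t2) = (1 - F t1) * F t2.
Hypothesis Y_Join : forall t1 t2, Y (Join t1 t2) = Y t1 + Y t2 - 2 * (F t1 * F t2).

Let p m := E m F.
Let y m := E m Y.
Let q m := E m (fun t => F t * Y t).
Let v m := E m (fun t => Y t ^+ 2).

Lemma E_F_rec m :
  m.+1%:R * p m.+1 = \sum_(k < m.+1) (1 - p k) * p (m - k)%N.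
Proof.
rewrite split_E; apply: eq_bigr => k _; rewrite -/(EE _ _ _).
rewrite (@eq_EE _ _ _ _ (fun t1 t2 => F t2 + (-1) * (F t1 * F t2))); last first.
  by move=> t1 t2; rewrite F_Join; ring.
by rewrite EE_D EE_Z EE_M EE_r /p; ring.
Qed.

Lemma E_Y_rec m :
  m.+1%:R * y m.+1 = 2 * \sum_(k < m.+1) y k - 2 * conv p p m.
Proof.
rewrite split_E mulr_natl mulr2n -{2}(sum_rev y) mulr_sumr -sumrN -!big_split /=.
apply: eq_bigr => k _; rewrite -/(EE _ _ _).
rewrite (@eq_EE _ _ _ _ (fun t1 t2 => Y t1 + (Y t2 + (-2) * (F t1 * F t2)))); last first.
  by move=> t1 t2; rewrite Y_Join; ring.
by rewrite !EE_D EE_Z EE_M EE_r EE_l /y /p; ring.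
Qed.

Lemma E_FY_rec m :
  m.+1%:R * q m.+1 = \sum_(k < m.+1) q k - 2 * conv q p m + conv y p m.
Proof.
rewrite [2 * _]mulr_natl mulr2n {2}(convC q).
rewrite split_E -(sum_rev q) opprD -!sumrN -!big_split /=.
apply: eq_bigr => k _; rewrite -/(EE _ _ _).
rewrite (@eq_EE _ _ _ _ (fun t1 t2 => Y t1 * F t2 + (F t2 * Y t2
  + ((-1) * (F t1 * Y t1 * F t2) + (-1) * (F t1 * (F t2 * Y t2)))))); last first.
  by move=> t1 t2; rewrite F_Join Y_Join; ring: (FF t1) (FF t2).
by rewrite !EE_D !EE_Z (EE_M _ _ Y F) (EE_M _ _ (fun t => F t * Y t) F)
  (EE_M _ _ F (fun t => F t * Y t)) EE_r /q /y /p; ring.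
Qed.

Lemma E_sqrY_rec m :
  m.+1%:R * v m.+1 = 2 * \sum_(k < m.+1) v k +
  (2 * conv y y m + 4 * conv p p m - 8 * conv q p m).
Proof.
rewrite (_ : 8 * conv q p m = 4 * conv q p m + 4 * conv p q m); last first.
  by rewrite (convC p q); ring.
rewrite split_E [in RHS]mulr_natl mulr2n -{2}(sum_rev v) opprD.
rewrite !mulr_sumr -!sumrN -!big_split /=.
apply: eq_bigr => k _; rewrite -/(EE _ _ _).
rewrite (@eq_EE _ _ _ _ (fun t1 t2 => Y t1 ^+ 2 + (Y t2 ^+ 2 +
  (2 * (Y t1 * Y t2) + (4 * (F t1 * F t2)
  + ((-4) * (F t1 * Y t1 * F t2) + (-4) * (F t1 * (F t2 * Y t2)))))))); last first.
  by move=> t1 t2; rewrite Y_Join; ring: (FF t1) (FF t2).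
by rewrite !EE_D !EE_Z (EE_M _ _ Y Y) (EE_M _ _ F F) (EE_M _ _ (fun t => F t * Y t) F)
  (EE_M _ _ F (fun t => F t * Y t)) (EE_l _ _ (fun t => Y t ^+ 2))
  (EE_r _ _ (fun t => Y t ^+ 2)) /q /y /p /v; ring.
Qed.

End join_recurrences.

Section moments.
Variable R : realType.
Implicit Types (c : R) (t : shape) (m k n : nat).

Definition fr t : R := (free t)%:R.

(** Centring by a multiple of the order, which is additive under [Join], leaves the recursion of
    [nul] unchanged for every [c]. *)
Definition cnul c t : R := (nul t)%:~R - c * (order t)%:R.

Definition prob_free m : R := E m fr.
Definition mean c m : R := E m (cnul c).
Definition mean_free c m : R := E m (fun t => fr t * cnul c t).
Definition msq c m : R := E m (fun t => cnul c t ^+ 2).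

Lemma fr_Join t1 t2 : fr (Join t1 t2) = (1 - fr t1) * fr t2.
Proof. by rewrite /fr /=; case: (free t1); case: (free t2); rewrite /= ?subrr ?mul0r ?mulr0 ?subr0 ?mulr1. Qed.

Lemma frr t : fr t * fr t = fr t.
Proof. by rewrite /fr; case: (free t); rewrite ?mulr1 ?mulr0. Qed.

Lemma cnul_Join c t1 t2 :
  cnul c (Join t1 t2) = cnul c t1 + cnul c t2 - 2 * (fr t1 * fr t2).
Proof.
rewrite /cnul /fr /= natrD rmorphB rmorphD /=.
by case: (free t1); case: (free t2); rewrite /= ?mulr0 ?mulr1 ?muln0 ?muln1 /=; ring.
Qed.

Lemma prob_free_rec m :
  m.+1%:R * prob_free m.+1 = \sum_(k < m.+1) (1 - prob_free k) * prob_free (m - k)%N.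
Proof. exact: E_F_rec fr_Join m. Qed.

Lemma mean_rec c m :
  m.+1%:R * mean c m.+1 =
  2 * \sum_(k < m.+1) mean c k - 2 * conv prob_free prob_free m.
Proof. exact: E_Y_rec (cnul_Join c) m. Qed.

Lemma mean_free_rec c m :
  m.+1%:R * mean_free c m.+1 =
  \sum_(k < m.+1) mean_free c k - 2 * conv (mean_free c) prob_free m
  + conv (mean c) prob_free m.
Proof. exact: E_FY_rec frr fr_Join (cnul_Join c) m. Qed.

(** The inhomogeneous term of a recurrence of quicksort type. It is O(m) as soon as [mean c] and
    [mean_free c] are bounded, which is what the choice of [c] achieves. *)
Definition toll c m : R :=
  2 * conv (mean c) (mean c) m + 4 * conv prob_free prob_free m
  - 8 * conv (mean_free c) prob_free m.

Lemma msq_rec c m :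
  m.+1%:R * msq c m.+1 = 2 * \sum_(k < m.+1) msq c k + toll c m.
Proof. exact: E_sqrY_rec frr (cnul_Join c) m. Qed.

End moments.

(** * Asymptotics of the moments *)

Lemma nested_intervals (R : realType) (l u : nat -> R) :
  (forall m, l m <= l m.+1) -> (forall m, u m.+1 <= u m) ->
  (forall m, l m <= u m) -> exists c, forall m, l m <= c <= u m.
Proof.
move=> l_incr u_decr lu.
have lmono : {homo l : m n / (m <= n)%N >-> m <= n}.
  by apply: homo_leq => // [x y z]; exact: le_trans.
have umono : {homo u : m n / (m <= n)%N >-> n <= m}.
  by apply: homo_leq => // [x y z yx zy]; exact: le_trans zy yx.
have lum m n : l m <= u n.
  apply: (le_trans (lmono _ _ (leq_maxl m n))).
  exact: (le_trans (lu _) (umono _ _ (leq_maxr m n))).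
have ub n : ubound (range l) (u n) by move=> _ [m _ <-].
exists (sup (range l)) => m; apply/andP; split.
  by apply: ub_le_sup; [exists (u 0%N) | exists m].
by apply: ge_sup => //; exists (l 0%N), 0%N.
Qed.

Lemma ler_norm_conv (R : realDomainType) (a b : nat -> R) A B m :
  (forall k, `|a k| <= A) -> (forall k, `|b k| <= B) ->
  `|conv a b m| <= A * B * m.+1%:R.
Proof.
move=> aA bB; apply: le_trans (ler_norm_sum _ _ _) _.
rewrite -[X in _ * X%:R](card_ord m.+1) -sumr_const mulr_sumr.
by apply: ler_sum => k _; rewrite normrM mulr1 ler_pM.
Qed.

(* Subtracting consecutive recurrences shows that
   [a (m + 1) / (m + 2) - B m / ((m + 1) (m + 2))] has increments O(m ^ -2). *)
Lemma quicksort_asymp (R : realType) (a B : nat -> R) T :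
  (forall m, m.+1%:R * a m.+1 = 2 * \sum_(k < m.+1) a k + B m) ->
  (forall m, `|B m| <= T * m.+1%:R) ->
  exists K C, forall m, `|a m - K * m.+1%:R| <= C.
Proof.
move=> rec BT.
have T0 : 0 <= T by have := le_trans (normr_ge0 _) (BT 0%N); rewrite mulr1.
have step m : m.+2%:R * a m.+2 = m.+3%:R * a m.+1 + B m.+1 - B m.
  have := rec m.+1; rewrite big_ord_recr /= mulrDr => ->.
  have -> : 2 * \sum_(k < m.+1) a k = m.+1%:R * a m.+1 - B m by rewrite rec; ring.
  by rewrite -[m.+3]addn2 natrD; ring.
pose w m := a m.+1 / m.+2%:R - B m / (m.+1%:R * m.+2%:R).
(* The differences of [e] telescope and dominate the increments of [w], so the intervals
   [[w m - e m, w m + e m]] are nested. *)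
pose e m : R := 2 * T / m.+2%:R.
have wS m : w m.+1 = w m + 2 * B m / (m.+1%:R * m.+2%:R * m.+3%:R).
  rewrite /w; have -> : a m.+2 = (m.+3%:R * a m.+1 + B m.+1 - B m) / m.+2%:R.
    by rewrite -step mulrAC divff ?mul1r ?pnatr_eq0.
  rewrite -[m.+3]addn1 -[m.+2]addn1 -[m.+1]addn1 !natrD.
  field.
  by rewrite -?natrD ?natr1 ?pnatr_eq0.
have eS m : e m - e m.+1 = 2 * T / (m.+2%:R * m.+3%:R).
  rewrite /e -[m.+3]addn1 natrD; field.
  by rewrite -?natrD ?natr1 ?pnatr_eq0.
have we m : `|w m.+1 - w m| <= e m - e m.+1.
  rewrite wS [w m + _]addrC addrK eS normrM [X in _ * X <= _]ger0_norm; last first.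
    by rewrite invr_ge0 !mulr_ge0.
  rewrite -[m.+1%:R * _ * _]mulrA [(m.+1%:R * (_ * _))^-1]invfM mulrA.
  rewrite ler_wpM2r ?invr_ge0 ?mulr_ge0 // ler_pdivrMr ?ltr0n //.
  rewrite normrM normr_nat -[2 * T * _]mulrA; apply: ler_wpM2l; first exact: ler0n.
  exact: BT.
have [||| K hK] := @nested_intervals R (fun m => w m - e m) (fun m => w m + e m).
- by move=> m /=; have := we m; rewrite ler_norml => /andP[h1 h2]; lra.
- by move=> m /=; have := we m; rewrite ler_norml => /andP[h1 h2]; lra.
- by move=> m /=; have : 0 <= e m by [rewrite divr_ge0 ?mulr_ge0]; lra.
exists K, (`|a 0%N - K| + 3 * T) => -[|m]; first by rewrite mulr1; lra.
have wK : `|w m - K| <= e m by have /andP[h1 h2] := hK m; rewrite ler_norml; lra.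
have -> : a m.+1 - K * m.+2%:R = m.+2%:R * (w m - K) + B m / m.+1%:R.
  rewrite /w -[m.+2]addn1 -[m.+1]addn1 !natrD; field.
  by rewrite -?natrD ?natr1 ?pnatr_eq0.
apply: le_trans (ler_normD _ _) _.
have h1 : `|m.+2%:R * (w m - K)| <= 2 * T.
  by rewrite normrM normr_nat mulrC -ler_pdivlMr ?ltr0n.
have h2 : `|B m / m.+1%:R| <= T.
  by rewrite normrM normfV normr_nat ler_pdivrMr ?ltr0n.
by have := normr_ge0 (a 0%N - K); lra.
Qed.

(** * Boundedness of the centred moments *)

Section moment_bounds.
Variable R : realType.
Local Notation p := (@prob_free R).

Lemma prob_free0 : p 0 = 1. Proof. by rewrite /prob_free E0. Qed.

Lemma prob_free1 : p 1 = 0.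
Proof. by have := prob_free_rec R 0; rewrite big_ord1 prob_free0 subrr mul0r mul1r. Qed.

Lemma prob_free2 : p 2 = 2^-1.
Proof.
have := prob_free_rec R 1; rewrite !big_ord_recl big_ord0 /= prob_free0 prob_free1.
by move=> h; lra.
Qed.

Lemma prob_free_ge0 m : 0 <= p m.
Proof. by apply: ge0_E => t; exact: ler0n. Qed.

Lemma prob_free_le1 m : p m <= 1.
Proof. by rewrite -(E_cst m (1 : R)); apply: le_E => t; rewrite /fr; case: free; rewrite ?ler01. Qed.

Lemma norm_prob_free m : `|p m| <= 1.
Proof. by rewrite ger0_norm ?prob_free_ge0 ?prob_free_le1. Qed.

(** The recurrence of [prob_free] read backwards: it makes the quadratic term in the recurrence of
    the mean linear, so that [mean_step] is free of sums. *)
Lemma conv_prob_free m : conv p p m = \sum_(k < m.+1) p k - m.+1%:R * p m.+1.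
Proof.
rewrite prob_free_rec -(sum_rev p) -sumrB; apply: eq_bigr => k _.
by ring.
Qed.

(** Pairing [k] with [m - k] reduces this to (1 - x) z + (1 - z) x <= 1 on the unit square. It makes
    the coefficients [1 - 2 * p j] with [j > 0] nonnegative in the bound on [mean_free]. *)
Lemma prob_free_le_half m : p m.+1 <= 2^-1.
Proof.
have : 2 * (m.+1%:R * p m.+1) <= m.+1%:R.
  rewrite {1}prob_free_rec mulr_natl mulr2n.
  rewrite -[X in X + _](sum_rev (fun k => (1 - p k) * p (m - k)%N)) -big_split /=.
  rewrite -[X in _ <= X%:R](card_ord m.+1) -sumr_const ler_sum // => k _.
  have km : (k <= m)%N by rewrite -ltnS.
  rewrite subKn //.
  have := prob_free_ge0 k; have := prob_free_ge0 (m - k).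
  have := prob_free_le1 k; have := prob_free_le1 (m - k).
  by move: (p k) (p (m - k)) => x z; nra.
rewrite mulrCA -ler_pdivlMl ?ltr0n // mulVf ?pnatr_eq0 //.
by move=> h; lra.
Qed.

Lemma mean_shift c m : mean c m = mean (0 : R) m - c * m.+1%:R.
Proof.
rewrite /mean (E_order m (fun n t => (nul t)%:~R - c * n%:R)) E_B E_cst.
by congr (_ - _); apply: eq_E => t; rewrite /cnul mul0r subr0.
Qed.

Lemma mean_step m :
  m.+1%:R * mean (0 : R) m.+1 = m.+2%:R * mean 0 m - 2 * m.+1%:R * (p m - p m.+1).
Proof.
rewrite mean_rec conv_prob_free; case: m => [|m].
  by rewrite !big_ord1; ring.
have := mean_rec (0 : R) m; rewrite conv_prob_free => h.
rewrite big_ord_recr /= mulrDr.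
have -> : 2 * \sum_(k < m.+1) mean 0 k =
  m.+1%:R * mean (0 : R) m.+1 + 2 * (\sum_(k < m.+1) p k - m.+1%:R * p m.+1) by rewrite h; ring.
rewrite [\sum_(k < m.+2) p k]big_ord_recr /= -[m.+3]addn2 -[m.+2]addn1 !natrD.
by rewrite -[m.+1]addn1 !natrD; ring.
Qed.

Lemma bounded_mean : exists2 c : R, 0 <= c & forall m, `|mean c m| <= 2.
Proof.
(* Removing [2 * p m] turns the step of the mean into an increment between 0 and
   [2 / ((m + 1) (m + 2))]. Thus [c] lies within [2 / (m + 1)] above [b m], and the bound 2 follows
   on multiplying by [m + 1]. *)
pose b m := (mean (0 : R) m - 2 * p m) / m.+1%:R.
have bS m : b m.+1 = b m + 2 * p m / (m.+1%:R * m.+2%:R).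
  have -> : b m.+1 = (m.+1%:R * mean 0 m.+1 - 2 * m.+1%:R * p m.+1) / (m.+1%:R * m.+2%:R).
    rewrite /b -[m.+2]addn1 -[m.+1]addn1 !natrD; field.
    by rewrite -?natrD ?natr1 ?pnatr_eq0.
  rewrite mean_step /b -[m.+2]addn1 -[m.+1]addn1 !natrD; field.
  by rewrite -?natrD ?natr1 ?pnatr_eq0.
have dS m : 2 / m.+2%:R = 2 / m.+1%:R - 2 / (m.+1%:R * m.+2%:R) :> R.
  rewrite -[m.+2]addn1 -[m.+1]addn1 !natrD; field.
  by rewrite -?natrD ?natr1 ?pnatr_eq0.
have V0 m : 0 <= 2 * p m / (m.+1%:R * m.+2%:R).
  by apply: divr_ge0; apply: mulr_ge0 => //; exact: prob_free_ge0.
have [||| c hc] := @nested_intervals R b (fun m => b m + 2 / m.+1%:R).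
- by move=> m /=; rewrite bS lerDl.
- move=> m /=; rewrite bS (dS m).
  have : 2 * p m / (m.+1%:R * m.+2%:R) <= 2 / (m.+1%:R * m.+2%:R).
    by rewrite ler_wpM2r ?invr_ge0 ?mulr_ge0 // ler_piMr ?prob_free_le1.
  move: (2 * p m / _) (2 / (m.+1%:R * m.+2%:R) : R) (2 / m.+1%:R : R) (b m) => x z d B h.
  by lra.
- by move=> m /=; rewrite lerDl divr_ge0.
exists c.
  (* [b 1 = 0] is one of the lower bounds of [c]. *)
  have /andP[+ _] := hc 1%N; rewrite bS prob_free0 /b prob_free0.
  by rewrite /mean E0 /cnul /=; move=> h; lra.
move=> m; have -> : mean c m = m.+1%:R * (b m - c) + 2 * p m.
  rewrite mean_shift /b; field; by rewrite ?nat1r ?natr1 pnatr_eq0.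
have /andP[h1 h2] := hc m.
have h3 : m.+1%:R * (b m - c) <= 0 by rewrite mulr_ge0_le0 // subr_le0.
have h4 : -2 <= m.+1%:R * (b m - c).
  rewrite mulrC -ler_pdivrMr ?ltr0n // mulNr.
  by move: h2; move: (2 / _ : R) (b m : R) => x B h2; lra.
have := prob_free_ge0 m; have := prob_free_le1 m.
by rewrite ler_norml; lra.
Qed.

Lemma bounded_mean_free c : (forall m, `|mean c m| <= 2) ->
  exists C : R, forall m, `|mean_free c m| <= C.
Proof.
move=> y2; pose q := mean_free c.
(* Three base cases provide [p 0 + p 1 + p 2 = 3 / 2] as a lower bound for [S]; with it, [C >= 3]
   suffices for [2 * S <= C * (2 * S - 2)]. *)
pose C := `|q 0%N| + `|q 1%N| + `|q 2%N| + 3; exists C.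
have [q0 q1 q2] := And3 (normr_ge0 (q 0%N)) (normr_ge0 (q 1%N)) (normr_ge0 (q 2%N)).
elim/ltn_ind => -[|[|[|m]]] IH; rewrite -/(q _); [by rewrite /C; lra|by rewrite /C; lra|by rewrite /C; lra|].
set n := m.+2 in IH *; pose S := \sum_(k < n.+1) p k.
have S32 : 3 / 2 <= S.
  rewrite /S !big_ord_recl /= prob_free0 prob_free1 prob_free2.
  have := @sumr_ge0 R 'I_m (index_enum 'I_m) xpredT (fun i => p (bump 0 (bump 0 (bump 0 i))))
    (fun _ _ => prob_free_ge0 _).
  by move: (\sum_(i < m) _) => s; lra.
(* The coefficients [1 - 2 * p j] of [q] have absolute values summing to [n + 1 - 2 * S + 2]; the
   final 2 corrects the term [j = 0], where the coefficient is -1. The deficit [2 * S - 2] absorbs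
   the contribution [2 * S] of the mean. *)
have h : `|n.+1%:R * q n.+1| <= C * (n.+1%:R - 2 * S + 2) + 2 * S.
  rewrite mean_free_rec [conv (mean c) _ _]convC.
  have -> : \sum_(k < n.+1) mean_free c k - 2 * conv (mean_free c) p n =
            \sum_(k < n.+1) q k * (1 - 2 * p (n - k)%N).
    rewrite mulr_sumr -sumrB; apply: eq_bigr => k _; rewrite /q; ring.
  apply: le_trans (ler_normD _ _) _; apply: lerD.
    rewrite (_ : n.+1%:R - 2 * S + 2 =
      \sum_(k < n.+1) (1 - 2 * p (n - k)%N + ((n - k)%N == 0%N)%:R * 2)); last first.
      rewrite big_split /= (sum_rev (fun j => 1 - 2 * p j) n) sumrB sumr_const card_ord.
      rewrite (sum_rev (fun j => (j == 0%N)%:R * 2 : R) n) -mulr_sumr -/S.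
      congr (_ + _); rewrite big_ord_recl /= mul1r big1 ?addr0 // => i _.
      by rewrite mul0r.
    rewrite mulr_sumr; apply: le_trans (ler_norm_sum _ _ _) (ler_sum _ _) => k _.
    rewrite normrM ler_pM // ?IH //.
    case: (n - k)%N => [|j] /=; first by rewrite prob_free0 ler_norml; lra.
    by have := prob_free_le_half j; have := prob_free_ge0 j.+1; rewrite ler_norml; lra.
  rewrite mulr_sumr; apply: le_trans (ler_norm_sum _ _ _) (ler_sum _ _) => k _.
  by rewrite normrM (ger0_norm (prob_free_ge0 _)) mulrC ler_wpM2r ?prob_free_ge0.
rewrite -(ler_pM2l (ltr0Sn R n)) -[X in X * `|_|]normr_nat -normrM.
apply: le_trans h _; rewrite mulrC.
have C3 : 3 <= C by rewrite /C; lra.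
have := mulr_ge0 (_ : 0 <= C - 3) (_ : 0 <= S - 3 / 2).
rewrite !subr_ge0 => /(_ C3 S32).
move: (n.+1%:R : R) (C : R) (S : R) C3 S32 => N D T D3 T32 h; lra.
Qed.

Lemma msq_asymp c : (forall m, `|mean c m| <= 2) ->
  exists K C : R, forall m, `|msq c m - K * m.+1%:R| <= C.
Proof.
move=> y2; have [Q hQ] := bounded_mean_free y2.
apply: (@quicksort_asymp R (msq c) (toll c) (8 + 4 + 8 * Q)); first exact: msq_rec.
move=> m; have h1 := ler_norm_conv m y2 y2.
have h2 := ler_norm_conv m norm_prob_free norm_prob_free.
have h3 := ler_norm_conv m hQ norm_prob_free.
rewrite /toll; move: h1 h2 h3; rewrite !ler_norml.
move: (conv _ _ _) (conv _ _ _) (conv _ _ _) => x1 x2 x3.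
by rewrite !mulr1 => /andP[? ?] /andP[? ?] /andP[? ?]; apply/andP; split; lra.
Qed.

End moment_bounds.

(** * The nullity of a tree *)

(* [e u w] means that [u] is the parent of [w]. With [U] the unitriangular matrix
   whose row [w] is [e_w - e_(parent w) / d w], the matrix is [U^T diag(d) U]. *)
Lemma det_increasing_tree (F : fieldType) n (e : rel 'I_n) (d : 'I_n -> F) (x : F) :
  (forall v, d v != 0) ->
  (forall u w, e u w -> (u < w)%N) ->
  (forall u v w, e u w -> e v w -> u = v) ->
  (forall v, d v + \sum_w (e v w)%:R / d w = x) ->
  \det (x%:M - \matrix_(i, j) (e i j || e j i)%:R) = \prod_v d v.
Proof.
move=> d0 elt eu dx.
pose U : 'M[F]_n := \matrix_(w, v) ((v == w)%:R - (e v w)%:R / d w).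
have detU : \det U = 1.
  rewrite det_trig; last first.
    apply/is_trig_mxP => w v wv; rewrite mxE.
    have /negPf-> : v != w by apply: contraTneq wv => ->; rewrite ltnn.
    have /negPf-> : ~~ e v w by apply: contraL wv => /elt; rewrite -leqNgt => /ltnW.
    by rewrite mul0r subr0.
  apply: big1 => w _; rewrite mxE eqxx.
  have /negPf-> : ~~ e w w by apply/negP => /elt; rewrite ltnn.
  by rewrite mul0r subr0.
suff -> : x%:M - \matrix_(i, j) (e i j || e j i)%:R = U^T *m diag_mx (\row_v d v) *m U.
  rewrite !det_mulmx det_tr detU det_diag mul1r mulr1.
  by apply: eq_bigr => v _; rewrite mxE.
apply/matrixP => u v; rewrite !mxE.
under eq_bigr => w _ do rewrite mul_mx_diag !mxE.
have E1 w : ((u == w)%:R - (e u w)%:R / d w) * d w * ((v == w)%:R - (e v w)%:R / d w) =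
   ((u == w) && (v == w))%:R * d w - (u == w)%:R * (e v w)%:R - (v == w)%:R * (e u w)%:R
   + (u == v)%:R * ((e u w)%:R / d w).
  have -> : (u == v)%:R * ((e u w)%:R / d w) = (e u w)%:R * (e v w)%:R / d w.
    rewrite mulrA; congr (_ / _); case: eqP => [->|uv]; rewrite ?mul1r ?mul0r.
      by case: (e v w); rewrite ?mulr1 ?mulr0.
    case: (boolP (e u w)) => [uw|]; rewrite ?mul0r // mul1r.
    by case: (boolP (e v w)) => // vw; case: uv; exact: eu uw vw.
  by rewrite -mulnb natrM; field; exact: d0.
under eq_bigr => w _ do rewrite E1.
rewrite big_split /= -mulr_sumr !sumrB.
have s1 : \sum_(w < n) (u == w)%:R * (e v w)%:R = (e v u)%:R :> F.
  rewrite (bigD1 u) //= eqxx mul1r big1 ?addr0 // => w /negPf.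
  by rewrite eq_sym => ->; rewrite mul0r.
have s2 : \sum_(w < n) (v == w)%:R * (e u w)%:R = (e u v)%:R :> F.
  rewrite (bigD1 v) //= eqxx mul1r big1 ?addr0 // => w /negPf.
  by rewrite eq_sym => ->; rewrite mul0r.
have s3 : \sum_(w < n) ((u == w) && (v == w))%:R * d w = (u == v)%:R * d u.
  rewrite (bigD1 u) //= eqxx /= big1 ?addr0 1?eq_sym // => w /negPf.
  by rewrite eq_sym => ->; rewrite mul0r.
rewrite s1 s2 s3 -mulr_natl.
have -> : (e u v || e v u)%:R = (e u v)%:R + (e v u)%:R :> F.
  case: (boolP (e u v)) => [uv|_] /=; rewrite ?add0r //.
  have /negPf-> : ~~ e v u by apply: contraL (elt _ _ uv) => /elt; rewrite -leqNgt => /ltnW.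
  by rewrite addr0.
by rewrite -{1}(dx u); ring.
Qed.

Inductive ltree : Type := LLeaf of nat | LJoin of ltree & ltree.

Fixpoint strip t :=
  match t with LLeaf _ => Leaf | LJoin t1 t2 => Join (strip t1) (strip t2) end.

Fixpoint lroot t := match t with LLeaf a => a | LJoin _ t2 => lroot t2 end.

Fixpoint labels t : seq nat :=
  match t with LLeaf a => [:: a] | LJoin t1 t2 => labels t1 ++ labels t2 end.

(* The pairs (parent, child). *)
Fixpoint ledges t : seq (nat * nat) :=
  match t with
  | LLeaf _ => [::]
  | LJoin t1 t2 => (lroot t2, lroot t1) :: ledges t1 ++ ledges t2
  end.

(** Each [LJoin] sends the new vertex [m] to the part containing [j], so the leaf reached is [j]
    itself whenever [j] occurs in the tree. *)
Fixpoint lins (j m : nat) t :=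
  match t with
  | LLeaf a => LJoin (LLeaf m) (LLeaf a)
  | LJoin t1 t2 =>
      if j \in labels t1 then LJoin (lins j m t1) t2 else LJoin t1 (lins j m t2)
  end.

Lemma lroot_in t : lroot t \in labels t.
Proof. by elim: t => [a|t1 _ t2 h] /=; rewrite ?mem_head // mem_cat h orbT. Qed.

Lemma ledges_in t a b : (a, b) \in ledges t -> (a \in labels t) && (b \in labels t).
Proof.
elim: t => [//|t1 h1 t2 h2] /=; rewrite inE !mem_cat.
case/or3P => [/eqP[-> ->]|/h1/andP[-> ->]|/h2/andP[-> ->]] //; rewrite ?orbT //.
by rewrite !lroot_in orbT.
Qed.

Lemma ledges_not_root t a b : uniq (labels t) -> (a, b) \in ledges t -> b != lroot t.
Proof.
elim: t => [//|t1 h1 t2 h2] /=; rewrite cat_uniq inE mem_cat => /and3P[u1 /hasPn u12 u2].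
have notin2 w : w \in labels t1 -> w != lroot t2.
  by move=> wt1; apply: contraTneq wt1 => ->; exact/u12/lroot_in.
case/or3P => [/eqP[_ ->]|/ledges_in/andP[_ +]|]; first exact/notin2/lroot_in.
  exact: notin2.
exact: h2.
Qed.

Lemma lroot_lins j m t : lroot (lins j m t) = lroot t.
Proof. by elim: t => //= t1 _ t2 h; case: ifP. Qed.

Lemma labels_lins j m t : perm_eq (labels (lins j m t)) (m :: labels t).
Proof.
elim: t => [a|t1 h1 t2 h2] //=; case: ifP => _ /=.
  by rewrite -cat_cons perm_cat2r.
apply: perm_trans (_ : perm_eq _ (labels t1 ++ m :: labels t2)) _.
  by rewrite perm_cat2l.
by rewrite -cat1s perm_catCA.
Qed.

Lemma ledges_lins j m t : j \in labels t ->
  perm_eq (ledges (lins j m t)) ((j, m) :: ledges t).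
Proof.
elim: t => [a|t1 h1 t2 h2] /=; first by rewrite inE => /eqP->.
rewrite mem_cat; case: ifP => [jt1 _|_ /= jt2] /=; rewrite lroot_lins.
  rewrite -[X in perm_eq _ X]/([:: (j, m)] ++ [:: _] ++ _).
  rewrite perm_sym perm_catCA /= perm_cons -cat_cons perm_cat2r perm_sym.
  exact: h1.
rewrite -[X in perm_eq _ X]/([:: (j, m)] ++ [:: _] ++ _).
rewrite perm_sym perm_catCA /= perm_cons -cat1s perm_catCA perm_cat2l perm_sym.
exact: h2.
Qed.

(** Distinct labels make choosing a vertex [j] the same as choosing an entry of [ins]. *)
Lemma sum_strip_lins (V : nmodType) (f : shape -> V) m t : uniq (labels t) ->
  \sum_(j <- labels t) f (strip (lins j m t)) = \sum_(s <- ins (strip t)) f s.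
Proof.
elim: t f => [a|t1 h1 t2 h2] f /=; first by rewrite !big_seq1.
rewrite cat_uniq => /and3P[u1 /hasPn u12 u2]; rewrite !big_cat !big_map /=.
congr (_ + _).
  rewrite -(h1 (fun s => f (Join s (strip t2)))) //.
  by rewrite big_seq [RHS]big_seq; apply: eq_bigr => j ->.
rewrite -(h2 (fun s => f (Join (strip t1) s))) //.
rewrite big_seq [RHS]big_seq; apply: eq_bigr => j /u12.
by rewrite /= => /negPf->.
Qed.

Section pivots.
Variable F : fieldType.
Implicit Types x : F.

(* Eliminating the vertices of [t] from the leaves upwards turns [x%:M] minus
   the adjacency matrix into a diagonal matrix: [pivot x t] is its entry at the
   root and [subpivots x t] the product of the other ones. *)
Fixpoint pivot x t : F :=
  match t with Leaf => x | Join t1 t2 => pivot x t2 - (pivot x t1)^-1 end.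

Fixpoint subpivots x t : F :=
  match t with
  | Leaf => 1
  | Join t1 t2 => pivot x t1 * subpivots x t1 * subpivots x t2
  end.

Fixpoint lpivot x t v : F :=
  match t with
  | LLeaf a => x
  | LJoin t1 t2 =>
      if v \in labels t1 then lpivot x t1 v
      else if v == lroot t2 then lpivot x t2 v - (lpivot x t1 (lroot t1))^-1
      else lpivot x t2 v
  end.

Lemma lpivot_root x t : uniq (labels t) -> lpivot x t (lroot t) = pivot x (strip t).
Proof.
elim: t => [//|t1 h1 t2 h2] /=; rewrite cat_uniq => /and3P[u1 /hasPn u12 u2].
by rewrite (negPf (u12 _ (lroot_in t2))) eqxx h1 // h2.
Qed.

Lemma prod_lpivot x t : uniq (labels t) ->
  \prod_(v <- labels t) lpivot x t v = pivot x (strip t) * subpivots x (strip t).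
Proof.
move=> ut; rewrite (bigD1_seq _ (lroot_in t)) //= lpivot_root //.
congr (_ * _); elim: t ut => [a|t1 h1 t2 h2] /=.
  by rewrite big_cons big_nil eqxx.
rewrite cat_uniq big_cat /= => /and3P[u1 /hasPn u12 u2]; congr (_ * _).
  rewrite -h1 // -lpivot_root // -bigD1_seq ?lroot_in //.
  rewrite [LHS]big_seq_cond [RHS]big_seq_cond. apply: eq_big => v.
    rewrite /= andbT; case v1: (v \in labels t1) => //=.
    by apply: contraTneq v1 => ->; exact/u12/lroot_in.
  by case/andP=> ->.
rewrite -h2 // big_seq_cond [RHS]big_seq_cond; apply: eq_bigr => v /andP[/u12 /= v1 vr].
by rewrite (negPf v1) (negPf vr).
Qed.

(** Exactly the row condition that [det_increasing_tree] asks of its diagonal [d]. *)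
Lemma lpivot_children x t v : uniq (labels t) -> v \in labels t ->
  lpivot x t v + \sum_(ab <- ledges t | ab.1 == v) (lpivot x t ab.2)^-1 = x.
Proof.
elim: t => [a|t1 h1 t2 h2] /=; first by rewrite big_nil addr0.
rewrite cat_uniq mem_cat big_cons big_cat => /and3P[u1 /hasPn u12 u2] /=.
have S1 : \sum_(ab <- ledges t1 | ab.1 == v)
    (lpivot x (LJoin t1 t2) ab.2)^-1 =
    \sum_(ab <- ledges t1 | ab.1 == v) (lpivot x t1 ab.2)^-1.
  rewrite big_seq_cond [RHS]big_seq_cond; apply: eq_bigr => -[a b] /andP[/ledges_in/andP[_ b1] _].
  by rewrite /= b1.
have S2 : \sum_(ab <- ledges t2 | ab.1 == v)
    (lpivot x (LJoin t1 t2) ab.2)^-1 =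
    \sum_(ab <- ledges t2 | ab.1 == v) (lpivot x t2 ab.2)^-1.
  rewrite big_seq_cond [RHS]big_seq_cond; apply: eq_bigr => -[a b] /andP[ab _].
  have /andP[_ b2] := ledges_in ab.
  by rewrite /= (negPf (u12 _ b2)) (negPf (ledges_not_root u2 ab)).
rewrite /= in S1 S2; rewrite S1 S2 lroot_in.
have outside t : v \notin labels t -> \sum_(ab <- ledges t | ab.1 == v) (lpivot x t ab.2)^-1 = 0.
  move=> vt; rewrite big_seq_cond big1 // => -[a b] /andP[/ledges_in/andP[at_ _] /eqP /= av].
  by rewrite -av at_ in vt.
case: ifPn => [v1 _|v1 /= v2].
  have v2 : v \notin labels t2 by apply: contraL v1 => /u12.
  rewrite (outside t2 v2) addr0 eq_sym.
  have /negPf-> : v != lroot t2 by apply: contraNneq v2 => ->; exact: lroot_in.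
  exact: h1.
rewrite (outside t1 v1) add0r eq_sym.
by case: ifP => _; rewrite -[RHS](h2 u2 v2) // addrA subrK.
Qed.

End pivots.

Arguments pivot {F} x t.
Arguments subpivots {F} x t.
Arguments lpivot {F} x t v.

(** * Leading exponents at 0 from the right *)

Section order_at_zero.
Variable R : realType.
Implicit Types (f g : R -> R) (k l : int) (a b : R).

(* [f x] is equivalent to [a * x ^ k] at [0^'+] when [a != 0]. *)
Definition equiv0 f k a := f x * x ^ (- k) @[x --> 0^'+] --> a.

Lemma near0_neq0 : \forall x \near (0 : R)^'+, x != 0.
Proof. by near=> x; rewrite gt_eqF //; near: x; exact: nbhs_right_gt. Unshelve. all: end_near. Qed.

Lemma equiv0_id : equiv0 id 1 1.
Proof.
apply: cvg_near_cst; near=> x.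
have x0 : x != 0 by near: x; exact: near0_neq0.
by rewrite exprN1 divff.
Unshelve. all: end_near. Qed.

Lemma equiv0_cst a : equiv0 (fun=> a) 0 a.
Proof.
apply: cvg_near_cst; near=> x.
by rewrite oppr0 expr0z mulr1.
Unshelve. all: end_near. Qed.

Lemma equiv0M f g k l a b : equiv0 f k a -> equiv0 g l b ->
  equiv0 (fun x => f x * g x) (k + l) (a * b).
Proof.
move=> fa gb; apply: cvg_trans (cvgM fa gb); apply: near_eq_cvg; near=> x.
have x0 : x != 0 by near: x; exact: near0_neq0.
by rewrite /= opprD expfzDr //; ring.
Unshelve. all: end_near. Qed.

Lemma equiv0V f k a : a != 0 -> equiv0 f k a -> equiv0 (fun x => (f x)^-1) (- k) a^-1.
Proof.
move=> a0 fa; apply: cvg_trans (cvgV a0 fa); apply: near_eq_cvg; near=> x.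
have x0 : x != 0 by near: x; exact: near0_neq0.
by rewrite /= invfM opprK invr_expz opprK.
Unshelve. all: end_near. Qed.

Lemma equiv0D f g k a b : equiv0 f k a -> equiv0 g k b ->
  equiv0 (fun x => f x + g x) k (a + b).
Proof.
move=> fa gb; apply: cvg_trans (cvgD fa gb); apply: near_eq_cvg; near=> x.
by rewrite /= mulrDl.
Unshelve. all: end_near. Qed.

Lemma equiv0N f k a : equiv0 f k a -> equiv0 (fun x => - f x) k (- a).
Proof.
move=> fa; apply: cvg_trans (cvgN fa); apply: near_eq_cvg; near=> x.
by rewrite /= mulNr.
Unshelve. all: end_near. Qed.

Lemma equiv0_lt f k l a : l < k -> equiv0 f k a -> equiv0 f l 0.
Proof.
move=> lk fa.
have [n kE] : exists n : nat, k = l + n.+1%:Z.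
  by exists (`|k - l|%N.-1); lia.
rewrite {}kE {lk} in fa *; have xn : x ^+ n.+1 @[x --> (0:R)^'+] --> (0 : R).
  have := @exprn_continuous R n.+1 0; rewrite /continuous_at expr0n /= => h.
  exact: cvg_at_right_filter.
rewrite -(mulr0 a); apply: cvg_trans (cvgM fa xn); apply: near_eq_cvg; near=> x.
have x0 : x != 0 by near: x; exact: near0_neq0.
rewrite /= -mulrA; congr (_ * _).
by rewrite -[x ^+ n.+1]/(x ^ n.+1%:Z) -expfzDr //; congr (_ ^ _); lia.
Unshelve. all: end_near. Qed.

Lemma equiv0_uniq f k l a b : a != 0 -> b != 0 ->
  equiv0 f k a -> equiv0 f l b -> k = l.
Proof.
move=> a0 b0 fa fb; case: (ltgtP k l) => // [kl|lk].
  have := cvg_unique _ fa (equiv0_lt kl fb) => /(_ (@Rhausdorff R)) E.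
  by rewrite E eqxx in a0.
have := cvg_unique _ fb (equiv0_lt lk fa) => /(_ (@Rhausdorff R)) E.
by rewrite E eqxx in b0.
Qed.

Lemma equiv0_near_neq0 f k a : a != 0 -> equiv0 f k a ->
  \forall x \near 0^'+, f x != 0.
Proof.
move=> a0 fa; have : \forall x \near (0:R)^'+, f x * x ^ (- k) != 0.
  exact: (cvgr_neq0 a fa a0).
by apply: filterS => x; apply: contraNneq => ->; rewrite mul0r.
Qed.

Lemma equiv0_horner (p : {poly R}) : p != 0 ->
  exists2 a : R, a != 0 & equiv0 (horner p) (mup 0 p)%:Z a.
Proof.
move=> p0; have [m [q]] := multiplicity_XsubC p 0; rewrite p0 /= => q0 pE.
have mE : mup 0 p = m by rewrite pE mupMr // mup_XsubCX eqxx.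
exists q.[0]; first exact: q0.
have : q.[x] @[x --> (0 : R)^'+] --> q.[0].
  by apply: cvg_at_right_filter; exact: continuous_horner.
move=> H; rewrite /equiv0; apply: (cvg_trans _ H); apply: near_eq_cvg; near=> x.
have x0 : x != 0 by near: x; exact: near0_neq0.
by rewrite mE pE !hornerE subr0 -mulrA -exprnN divff ?mulr1 // expf_neq0.
Unshelve. all: end_near. Qed.

(** The exponent of [x] in the leading term of the root pivot. *)
Definition sg (t : shape) : int := if free t then 1 else -1.

(** The sign of the leading coefficient belongs to the induction: when exactly one part is free,
    both terms of the new pivot have the same exponent, and they add up without cancelling because
    their coefficients have equal signs. *)
Lemma pivot_equiv t : exists2 a : R,
  if free t then 0 < a else a < 0 & equiv0 (pivot^~ t) (sg t) a.
Proof.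
elim: t => [|t1 [a1 a1s h1] t2 [a2 a2s h2]].
  by exists 1; rewrite //=; exact: equiv0_id.
have a1_neq0 : a1 != 0 by apply: contraTneq a1s => ->; rewrite ltxx; case: ifP.
have h1V := equiv0N (equiv0V a1_neq0 h1).
move: a1s a2s h2 h1V {h1}; rewrite /sg /=.
case: (free t1); case: (free t2); rewrite /= ?opprK => a1s a2s h2 h1V.
- exists (0 - a1^-1); first by rewrite sub0r oppr_lt0 invr_gt0.
  by apply: equiv0D h1V; exact: equiv0_lt h2.
- exists (a2 - a1^-1); last exact: equiv0D.
  by rewrite subr_lt0 (lt_trans a2s) // invr_gt0.
- exists (a2 - a1^-1); last exact: equiv0D.
  by rewrite subr_gt0 (lt_trans _ a2s) // invr_lt0.
- exists (a2 + 0); first by rewrite addr0.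
  by apply: equiv0D h2 _; exact: equiv0_lt h1V.
Qed.

(** Joining changes the exponent of the root pivot of [t2] only when both roots are free, from 1 to
    -1; this is where the 2 in [nul] comes from. *)
Lemma subpivots_equiv t :
  exists2 a : R, a != 0 & equiv0 (subpivots^~ t) (nul t - sg t) a.
Proof.
elim: t => [|t1 [b1 b1_neq0 g1] t2 [b2 b2_neq0 g2]].
  by exists 1; [exact: oner_neq0|exact: equiv0_cst].
have [a1 a1_gt0 h1] := pivot_equiv t1.
have a1_neq0 : a1 != 0 by apply: contraTneq a1_gt0 => ->; rewrite ltxx; case: ifP.
exists (a1 * b1 * b2); first by rewrite !mulf_neq0.
have := equiv0M (equiv0M h1 g1) g2.
congr (equiv0 _ _ _); rewrite /sg /=.
by case: (free t1); case: (free t2); rewrite /=; ring.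
Qed.

Lemma det_equiv t :
  exists2 a : R, a != 0 & equiv0 (fun x => pivot x t * subpivots x t) (nul t) a.
Proof.
have [a a_gt0 h] := pivot_equiv t; have [b b_neq0 g] := subpivots_equiv t.
exists (a * b).
  by rewrite mulf_neq0 //; apply: contraTneq a_gt0 => ->; rewrite ltxx; case: ifP.
by have := equiv0M h g; rewrite addrC subrK.
Qed.

End order_at_zero.

(** * Recursive trees as sequences of parents *)

Lemma path_ltn_last n (r : 'I_n) p :
  path (fun x y : 'I_n => (x < y)%N) r p -> forall y, y \in r :: p -> (y <= last r p)%N.
Proof.
elim: p r => [|a p IH] r /=; first by move=> _ y; rewrite inE => /eqP->.
move=> /andP[ra /IH h] y; rewrite inE => /predU1P[->|]; last exact: h.
by apply: leq_trans (ltnW ra) (h _ _); rewrite mem_head.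
Qed.

Lemma iota_rcons a n : iota a n.+1 = rcons (iota a n) (a + n)%N.
Proof. by rewrite -[n.+1]addn1 iotaD cats1. Qed.

(* A sequence [s] of size [m] encodes the graph on [0 .. m] in which the
   vertex [w > 0] is joined to [parent s w], the last entry of [s] being the
   parent of vertex 1. *)
Definition parent (s : seq nat) (w : nat) : nat := nth 0%N s (size s - w).

Definition pedges (s : seq nat) : seq (nat * nat) :=
  [seq (parent s w, w) | w <- iota 1 (size s)].

Definition increasing_parents (s : seq nat) : bool :=
  all (fun w => (parent s w < w)%N) (iota 1 (size s)).

Fixpoint pseqs (m : nat) : seq (seq nat) :=
  if m is k.+1 then [seq j :: s | s <- pseqs k, j <- iota 0 k.+1] else [:: [::]].

Fixpoint build (s : seq nat) : ltree :=
  if s is j :: s' then lins j (size s) (build s') else LLeaf 0.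

Lemma parent_cons j s w : (w <= size s)%N -> parent (j :: s) w = parent s w.
Proof. by move=> ws; rewrite /parent /= subSn. Qed.

Lemma pedges_cons j s : pedges (j :: s) = rcons (pedges s) (j, (size s).+1).
Proof.
rewrite /pedges [size (j :: s)]/= iota_rcons map_rcons add1n {2}/parent /= subnn /=; congr rcons.
by apply/eq_in_map => w; rewrite mem_iota add1n ltnS => /andP[_ ws]; rewrite parent_cons.
Qed.

Lemma mem_pedges s a b :
  ((a, b) \in pedges s) = [&& (0 < b)%N, (b <= size s)%N & parent s b == a].
Proof.
apply/mapP/and3P => [[w + [-> ->]]|[b0 bs /eqP <-]].
  by rewrite mem_iota add1n ltnS => /andP[-> ->].
by exists b; rewrite // mem_iota add1n ltnS b0.
Qed.

Lemma increasing_cons j s :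
  increasing_parents (j :: s) = (j <= size s)%N && increasing_parents s.
Proof.
rewrite /increasing_parents [size (j :: s)]/= iota_rcons all_rcons add1n.
rewrite {1}/parent /= subnn /= ltnS; congr (_ && _).
by apply: eq_in_all => w; rewrite mem_iota add1n ltnS => /andP[_ ws]; rewrite parent_cons.
Qed.

Lemma pseqsS m : pseqs m.+1 = [seq j :: s | s <- pseqs m, j <- iota 0 m.+1].
Proof. by []. Qed.

Lemma mem_pseqs m s : (s \in pseqs m) = (size s == m) && increasing_parents s.
Proof.
elim: m s => [|m IH] [|j s] //; rewrite pseqsS.
- by apply/negP => /allpairsPdep[s' [j []]].
rewrite increasing_cons [size _]/= eqSS andbCA -IH; apply/allpairsPdep/andP => [[s' [j' [s'm + [-> ->]]]]|[js sm]].
  by rewrite mem_iota add0n ltnS => ?; split=> //; move: s'm; rewrite IH => /andP[/eqP->].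
exists s, j; split=> //; rewrite mem_iota add0n ltnS /=.
by move: sm; rewrite IH => /andP[/eqP<-].
Qed.

Lemma uniq_pseqs m : uniq (pseqs m).
Proof.
elim: m => // m IH; rewrite pseqsS; apply: allpairs_uniq => //; first exact: iota_uniq.
by move=> [s j] [s' j'] _ _ /= [-> ->].
Qed.

Lemma labels_build s : perm_eq (labels (build s)) (iota 0 (size s).+1).
Proof.
elim: s => [|j s IH] //=; apply: perm_trans (labels_lins _ _ _) _.
rewrite -[X in perm_eq _ X]/(iota 0 (size s).+2) iota_rcons add0n.
by rewrite perm_sym perm_rcons perm_cons perm_sym.
Qed.

Lemma uniq_labels_build s : uniq (labels (build s)).
Proof. by rewrite (perm_uniq (labels_build s)) iota_uniq. Qed.

Lemma ledges_build s : increasing_parents s -> perm_eq (ledges (build s)) (pedges s).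
Proof.
elim: s => [//|j s IH]; rewrite increasing_cons => /andP[js /IH h].
rewrite pedges_cons; apply: perm_trans (ledges_lins _ _) _.
  by rewrite (perm_mem (labels_build s)) mem_iota add0n ltnS.
by rewrite perm_sym perm_rcons perm_cons perm_sym.
Qed.

Lemma sum_strip_build (V : nmodType) (f : shape -> V) m :
  \sum_(s <- pseqs m) f (strip (build s)) = \sum_(t <- shapes m) f t.
Proof.
elim: m f => [|m IH] f; first by rewrite !big_seq1.
rewrite pseqsS big_allpairs_dep [shapes m.+1]/= big_flatten big_map.
rewrite -(IH (fun t => \sum_(t' <- ins t) f t')) big_seq [RHS]big_seq.
apply: eq_bigr => s; rewrite mem_pseqs => /andP[/eqP sm _].
rewrite -(sum_strip_lins _ m.+1) ?uniq_labels_build //.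
by rewrite (perm_big _ (labels_build s)) sm; apply: eq_bigr => j _; rewrite /= sm.
Qed.

(** * The bijection between parent sequences and recursive trees *)

Section parent_graph.
Variable m : nat.
Implicit Types s : seq nat.

Definition is_child s : rel 'I_m.+1 := fun a b => (val a, val b) \in pedges s.

Definition pgraph s : Defs.rgraph m.+1 :=
  (ord0, [set xy | is_child s xy.1 xy.2 || is_child s xy.2 xy.1]%SET).

Lemma adj_pgraph s a b : adj (pgraph s) a b = is_child s a b || is_child s b a.
Proof. by rewrite /adj inE. Qed.

Lemma is_child_lt s a b : increasing_parents s -> is_child s a b -> (a < b)%N.
Proof.
move=> /allP inc; rewrite /is_child mem_pedges => /and3P[b0 bs /eqP<-].
by apply: inc; rewrite mem_iota b0 add1n ltnS.
Qed.

Lemma is_child_uniq s a a' b : is_child s a b -> is_child s a' b -> a = a'.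
Proof.
rewrite /is_child !mem_pedges => /and3P[_ _ /eqP E] /and3P[_ _ /eqP E'].
by apply: val_inj; rewrite -E -E'.
Qed.

Lemma adj_lt s a b : increasing_parents s -> adj (pgraph s) a b -> (a < b)%N ->
  is_child s a b.
Proof.
move=> inc; rewrite adj_pgraph => /orP[//|/(is_child_lt inc) ba] ab.
by have := ltn_trans ab ba; rewrite ltnn.
Qed.

Lemma adj_sym s : symmetric (adj (pgraph s)).
Proof. by move=> a b; rewrite !adj_pgraph orbC. Qed.

Lemma adj_irr s : increasing_parents s -> irreflexive (adj (pgraph s)).
Proof.
move=> inc a; rewrite adj_pgraph orbb; apply/negP => /(is_child_lt inc).
by rewrite ltnn.
Qed.

Lemma pgraph_is_tree s : size s = m -> increasing_parents s -> is_tree (adj (pgraph s)).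
Proof.
move=> sm inc; split; [exact: adj_sym|exact: adj_irr| |].
  have c0 v : connect (adj (pgraph s)) ord0 v.
    have [k] := ubnP (val v); elim: k v => // k IH v; rewrite ltnS => vk.
    have [v0|v0] := posnP (val v); first by rewrite (_ : v = ord0) //; exact: val_inj.
    have pv : (parent s v < v)%N.
      by apply: (allP inc); rewrite mem_iota v0 add1n ltnS sm -ltnS ltn_ord.
    have um : (parent s v < m.+1)%N by apply: ltn_trans pv _.
    apply: connect_trans (IH (Ordinal um) (leq_trans pv vk)) (connect1 _).
    by rewrite adj_pgraph /is_child mem_pedges v0 sm -ltnS ltn_ord /= eqxx.
  move=> x y; apply: connect_trans (c0 y).
  by rewrite (sym_connect_sym (@adj_sym s)).
move=> c /andP[cyc uc]; rewrite leqNgt; apply/negP => c2.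
have [x0 x0c] : exists x0, x0 \in c by case: c c2 {cyc uc} => // a c _; exists a; rewrite mem_head.
(* The largest vertex of a longer cycle would have two distinct smaller neighbours, both of them its
   parent. *)
case: (arg_maxnP (fun i : 'I_m.+1 => val i) x0c) => v vc vmax'.
have vmax z : z \in c -> (z <= v)%N by move=> /vmax'.
have [i c' rE] := rot_to vc.
have cc' : {subset c' <= c} by move=> x xc'; rewrite -(mem_rot i) rE inE xc' orbT.
have : cycle (adj (pgraph s)) (v :: c') by rewrite -rE rot_cycle.
have : uniq (v :: c') by rewrite -rE rot_uniq.
have : (2 < size (v :: c'))%N by rewrite -rE size_rot.
case: c' cc' {rE} => [//|x c'] cc'; case/lastP: c' cc' => [//|c' y] cc' _.
rewrite /= rcons_path => /and3P[+ xc' _] /andP[vx] /andP[_].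
rewrite last_rcons inE negb_or => /andP[/eqP vx_neq vc'] yv.
have below z : z \in x :: rcons c' y -> adj (pgraph s) z v -> is_child s z v.
  move=> zc zv; apply: adj_lt => //; rewrite ltn_neqAle vmax ?cc' // andbT.
  by apply: contraTneq zv => /val_inj ->; rewrite adj_irr.
have xv : adj (pgraph s) x v by rewrite adj_sym.
have y_in : y \in x :: rcons c' y by rewrite inE mem_rcons mem_head orbT.
have /is_child_uniq E := below x (mem_head _ _) xv.
by move: xc'; rewrite (E _ (below y y_in yv)) mem_rcons mem_head.
Qed.

(** A first descent from [y] to [z] leads to the parent of [y], which is the vertex visited just
    before [y], against simplicity of the path. *)
Lemma pgraph_increasing s : increasing_parents s ->
  increasing_from (adj (pgraph s)) ord0.
Proof.
move=> inc; elim/last_ind => [//|p z IH]; rewrite !rcons_path -rcons_cons rcons_uniq.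
move=> /andP[pp yz] /andP[zp up]; have ip := IH pp up; rewrite ip /=.
move: yz; rewrite adj_pgraph => /orP[/(is_child_lt inc)//|zy].
case/lastP: p zp pp ip zy {IH up} => [_ _ _ /(is_child_lt inc)//|p y].
rewrite last_rcons !rcons_path => zp /andP[_ y'y] /andP[_ /= lt_y'y] zy.
have y'y_child := adj_lt inc y'y lt_y'y.
move: zp; rewrite (is_child_uniq zy y'y_child) -rcons_cons mem_rcons inE negb_or.
by rewrite mem_last andbF.
Qed.

Lemma pgraph_recursive s : s \in pseqs m -> pgraph s \in recursive_trees m.+1.
Proof.
rewrite mem_pseqs => /andP[/eqP sm inc]; rewrite inE; apply/asboolP; split.
  exact: pgraph_is_tree.
exact: pgraph_increasing.
Qed.

Lemma pgraph_inj : {in pseqs m &, injective pgraph}.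
Proof.
move=> s s'; rewrite !mem_pseqs => /andP[/eqP sm inc] /andP[/eqP s'm inc'] E.
apply: (@eq_from_nth _ 0%N) => [|i]; rewrite ?sm ?s'm // => im.
pose w := (m - i)%N.
have w0 : (0 < w)%N by rewrite subn_gt0.
have wm : (w < m.+1)%N by rewrite ltnS leq_subr.
have pw : (parent s w < w)%N.
  by apply: (allP inc); rewrite mem_iota w0 add1n ltnS sm leq_subr.
have um := ltn_trans pw wm.
have : adj (pgraph s) (Ordinal um) (Ordinal wm).
  by rewrite adj_pgraph /is_child mem_pedges w0 sm leq_subr /= eqxx.
rewrite E => /(adj_lt inc')/(_ pw); rewrite /is_child mem_pedges => /and3P[_ _ /eqP].
by rewrite /parent /= sm s'm subKn ?(ltnW im).
Qed.

Lemma recursive_pgraph t : t \in recursive_trees m.+1 ->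
  exists2 s, s \in pseqs m & t = pgraph s.
Proof.
rewrite inE => /asboolP[[esym eirr econ _] inc].
case: t esym eirr econ inc => r A; rewrite /root_of /=; set e := adj _.
move=> esym eirr econ inc.
have simple_path v : exists p, [/\ path e r p, uniq (r :: p) & last r p = v].
  have /connectP[p pp ->] := econ r v.
  by case/shortenP: pp => p' pp' up' _; exists p'.
have r0 : r = ord0.
  have [p [pp up pl]] := simple_path ord0.
  apply: val_inj; apply/eqP; rewrite -leqn0.
  by rewrite -[0%N]/(val (ord0 : 'I_m.+1)) -pl (path_ltn_last (inc _ pp up)) ?mem_head.
(* The parent of [v] is its predecessor on a simple path from the root. *)
have lower (v : 'I_m.+1) : (0 < v)%N -> exists u : 'I_m.+1, e u v && (u < v)%N.
  have [p] := simple_path v; case/lastP: p => [|p y] [pp up].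
    by move=> /= <-; rewrite r0.
  rewrite last_rcons => <- _; have := inc _ pp up.
  by move: pp; rewrite !rcons_path => /andP[_ h1] /andP[_ h2]; exists (last r p); rewrite h1.
(* Vertices on an increasing path from the root to [u] are at most [u], so it extends by [v] and
   then [u'] to a simple path, which descends at its last step. *)
have lower_lt (u u' v : 'I_m.+1) : e u v -> e u' v -> (u' < v)%N -> (u < u')%N -> False.
  move=> uv u'v u'ltv uu'.
  have [p [pp up pl]] := simple_path u.
  have le_u := path_ltn_last (inc _ pp up); rewrite pl in le_u.
  have : path e r (p ++ [:: v; u']) by rewrite cat_path pp pl /= uv esym u'v.
  have : uniq (r :: p ++ [:: v; u']).
    rewrite -cat_cons cat_uniq up /= orbF negb_or inE.
    have -> : v \notin r :: p by apply/negP => /le_u; lia.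
    have -> : u' \notin r :: p by apply/negP => /le_u; lia.
    by rewrite /= inE !andbT; apply/eqP => E; move: u'ltv; rewrite E ltnn.
  move=> h1 h2; have := inc _ h2 h1; rewrite cat_path pl /= => /and4P[_ _ vu' _].
  by have := ltn_trans u'ltv vu'; rewrite ltnn.
have lower_uniq (u u' v : 'I_m.+1) : e u v -> e u' v -> (u < v)%N -> (u' < v)%N -> u = u'.
  move=> uv u'v ltu ltu'; apply: val_inj; case: (ltngtP (val u) (val u')) => // h; exfalso.
    exact: lower_lt uv u'v ltu' h.
  exact: lower_lt u'v uv ltu h.
pose f (w : nat) : nat := odflt ord0 [pick u : 'I_m.+1 | e u (inord w) && (u < w)%N].
have fP w (wm : (w < m.+1)%N) (u : 'I_m.+1) : e u (Ordinal wm) && (u < w)%N = (0 < w)%N && (f w == val u).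
  have wE : inord w = Ordinal wm by apply: val_inj; rewrite /= inordK.
  rewrite /f wE; case: pickP => [u' /andP[h1 h2]|none] /=.
    apply/andP/andP => [[h3 h4]|[w0 /eqP/val_inj <-]]; last by [].
    by rewrite (lower_uniq _ _ _ h1 h3 h2 h4) eqxx (leq_ltn_trans _ h4).
  rewrite none; symmetry; apply/negP => /andP[w0 _].
  by have [u'] := lower (Ordinal wm) w0; rewrite /= none.
pose s := rev [seq f w | w <- iota 1 m].
have sm : size s = m by rewrite size_rev size_map size_iota.
have par w : (0 < w <= m)%N -> parent s w = f w.
  move=> /andP[w0 wm]; rewrite /parent nth_rev ?size_map ?size_iota sm; last by lia.
  rewrite (nth_map 0%N) ?size_iota; last by lia.
  by congr f; rewrite nth_iota; lia.
have child (a b : 'I_m.+1) : is_child s a b = e a b && (a < b)%N.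
  rewrite /is_child mem_pedges sm.
  have bm : (b <= m)%N by rewrite -ltnS.
  have -> : e a b && (a < b)%N = (0 < b)%N && (f b == val a).
    by rewrite -(fP _ (ltn_ord b)); congr (e a _ && _); exact: val_inj.
  rewrite bm /=; case: (posnP b) => [->|b0] //=.
  by rewrite par ?b0.
exists s.
  rewrite mem_pseqs sm eqxx; apply/allP => w; rewrite mem_iota sm => /andP[w0 wm].
  have wm' : (w < m.+1)%N by rewrite -add1n.
  rewrite par ?w0 //=.
  have [u hu] := lower (Ordinal wm') w0.
  by move: (hu); rewrite fP => /andP[_ /eqP->]; move/andP: hu => [].
rewrite /pgraph r0; congr pair; apply/setP => -[a b]; rewrite !inE /= !child.
rewrite -[(a, b) \in A]/(e a b) (esym b a).
by case: (ltngtP a b) => [_|_|/val_inj ->]; rewrite ?andbT ?andbF ?orbF // eirr.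
Qed.

Lemma sum_recursive_trees (V : nmodType) (F : Defs.rgraph m.+1 -> V) :
  \sum_(t in recursive_trees m.+1) F t = \sum_(s <- pseqs m) F (pgraph s).
Proof.
rewrite -big_enum -(big_map pgraph xpredT) /=; apply: perm_big; apply: uniq_perm.
- exact: enum_uniq.
- by rewrite map_inj_in_uniq ?uniq_pseqs //; exact: pgraph_inj.
move=> t; rewrite mem_enum; apply/idP/mapP => [/recursive_pgraph[s]|[s sm ->]].
  by exists s.
exact: pgraph_recursive.
Qed.

End parent_graph.

(** The determinant formula divides by the pivots and so needs them nonzero. This holds for all
    small [x > 0], which is enough to compare the leading exponents of the two sides at 0. *)
Lemma N0_pgraph (R : realType) m s : s \in pseqs m ->
  (N0 R (pgraph m s))%:Z = nul (strip (build s)).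
Proof.
rewrite mem_pseqs /N0 => /andP[/eqP sm inc].
set t := build s; set A := adjmx R _; set chi := char_poly A.
have chiE x : pivot x (strip t) * subpivots x (strip t) != 0 ->
    chi.[x] = pivot x (strip t) * subpivots x (strip t).
  rewrite -prod_lpivot ?uniq_labels_build // => nz.
  have labE : \prod_(v <- labels t) lpivot x t v = \prod_(v < m.+1) lpivot x t v.
    by rewrite (perm_big _ (labels_build s)) sm -[LHS]/(\prod_(0 <= v < m.+1) _) big_mkord.
  rewrite labE in nz *.
  have d0 (v : 'I_m.+1) : lpivot x t v != 0.
    by apply: contra nz => /eqP d0; rewrite (bigD1 v) //= d0 mul0r.
  rewrite -(@det_increasing_tree _ _ (is_child s) _ x) //.
  - rewrite /chi /char_poly -horner_evalE -det_map_mx; congr (\det _).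
    apply/matrixP => i j; rewrite !mxE /= horner_evalE !hornerE hornerMn hornerX.
    by rewrite -adj_pgraph.
  - by move=> u w; exact: is_child_lt.
  - by move=> u v w; exact: is_child_uniq.
  move=> v; rewrite -[RHS](@lpivot_children _ x t v) ?uniq_labels_build //; last first.
    by rewrite (perm_mem (labels_build s)) mem_iota sm /= add0n.
  congr (_ + _); rewrite (perm_big _ (ledges_build inc)) /= /pedges big_map /=.
  rewrite sm [in RHS]big_mkcond [in RHS](_ : iota 1 m = index_iota 1 m.+1); last first.
    by rewrite /index_iota subSS subn0.
  rewrite -[in LHS](big_mkord xpredT (fun w => ((val v, w) \in pedges s)%:R / lpivot x t w)).
  (* The term [w = 0] vanishes, vertex 0 being nobody's child; the remaining range is that of
     [pedges]. *)
  rewrite big_ltn // mem_pedges /= mul0r add0r big_seq [RHS]big_seq; apply: eq_bigr => w.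
  rewrite mem_index_iota => /andP[w0 wm]; rewrite mem_pedges w0 sm -ltnS wm /=.
  by case: eqP; rewrite ?mul1r ?mul0r.
have chi0 : chi != 0 by rewrite monic_neq0 ?char_poly_monic.
have [a a0 ha] := equiv0_horner chi0.
have [b b0 hb] := det_equiv R (strip t).
apply: (equiv0_uniq a0 b0 ha).
have nz := equiv0_near_neq0 b0 hb.
apply: cvg_trans hb; apply: near_eq_cvg.
by apply: filterS nz => x /chiE ->.
Qed.

Lemma size_shapes m : size (shapes m) = m`!.
Proof.
have := E_cst m (1 : rat); rewrite /E big_const_seq count_predT iter_addr_0 => h.
apply/eqP; rewrite -(eqr_nat rat); apply/eqP.
have nz : m`!%:R != 0 :> rat by rewrite pnatr_eq0 -lt0n fact_gt0.
by have := congr1 ( *%R^~ m`!%:R) h; rewrite /= divfK // mul1r.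
Qed.

Lemma unif_mean_recursive (R : realType) m (f : nat -> R) (g : shape -> R) :
  (forall s, s \in pseqs m -> f (N0 R (pgraph m s)) = g (strip (build s))) ->
  unif_mean (recursive_trees m.+1) (fun t => f (N0 R t)) = E m g.
Proof.
move=> fg; rewrite /unif_mean sum_recursive_trees big_seq (eq_bigr _ fg) -big_seq.
rewrite (sum_strip_build g) /E; congr (_ / _%:R).
rewrite -size_shapes -sum1_card sum_recursive_trees.
by rewrite (sum_strip_build (fun=> 1%N)) sum1_size.
Qed.

Lemma var_N0_msq (R : realType) m (c : R) :
  var_N0 R m.+1 = msq c m - mean c m ^+ 2.
Proof.
have EN : unif_mean (recursive_trees m.+1) (fun t => (N0 R t)%:R) = mean (0 : R) m.
  apply: (@unif_mean_recursive R m (fun n => n%:R)) => s sm.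
  by rewrite /cnul mul0r subr0 -(N0_pgraph R sm).
rewrite /var_N0 /unif_var EN.
rewrite (@unif_mean_recursive R m (fun n => (n%:R - mean 0 m) ^+ 2)
  (fun t => ((nul t)%:~R - mean 0 m) ^+ 2)); last first.
  by move=> s sm; rewrite -(N0_pgraph R sm).
rewrite (mean_shift c).
have -> : msq c m = E m (fun t => ((nul t)%:~R - c * m.+1%:R) ^+ 2).
  exact: (E_order m (fun n t => ((nul t)%:~R - c * n%:R) ^+ 2)).
have E1 : E m (fun t => (nul t)%:~R) = mean (0 : R) m.
  by apply: eq_E => t; rewrite /cnul mul0r subr0.
have shift a : E m (fun t => ((nul t)%:~R - a) ^+ 2) =
    E m (fun t => (nul t)%:~R ^+ 2) - 2 * a * mean 0 m + a ^+ 2 :> R.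
  rewrite -E1 (@eq_E _ _ _ (fun t => (nul t)%:~R ^+ 2 - 2 * a * (nul t)%:~R + a ^+ 2)).
    by rewrite E_D E_B E_Z E_cst.
  by move=> t; ring.
by rewrite !shift; ring.
Qed.

(** * Power series *)

Section power_series.
Variable R : realType.
Implicit Types (a b : nat -> R) (x z r C : R).

(* The radius of convergence is at least 1. *)
Definition rad1 a : Prop :=
  forall r, 0 < r < 1 -> exists C, forall n, `|a n| * r ^+ n <= C.

Definition gf a z : R := limn (pseries a z).

Lemma mulnX_bounded r n : 0 < r < 1 -> n.+1%:R * r ^+ n <= (1 - r)^-1.
Proof.
move=> /andP[r0 r1]; rewrite -[leRHS]mul1r.
apply: le_trans (geometric_le_lim n.+1 ler01 r0 _); last by rewrite ger0_norm // ltW.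
rewrite /series /= big_mkord -[X in X%:R](card_ord n.+1) -sumr_const mulr_suml.
apply: ler_sum => k _; rewrite !mul1r.
by apply: ler_wiXn2l; [exact: ltW|exact: ltW|rewrite -ltnS].
Qed.

(** Of the four factors [r ^+ n], one absorbs the coefficient, two absorb the factors [n] arising in
    the Cauchy product, and the last tends to 0. *)
Lemma le_expr4_between z : `|z| < 1 -> exists2 r, 0 < r < 1 & `|z| <= r ^+ 4.
Proof.
move=> z1; have z0 := normr_ge0 z.
exists ((3 + `|z|) / 4); first by apply/andP; split; lra.
have h1 : (1 + `|z|) / 2 <= ((3 + `|z|) / 4) ^+ 2 by nra.
have h2 : `|z| <= ((1 + `|z|) / 2) ^+ 2 by nra.
apply: le_trans h2 _; rewrite -[4%N]/(2 * 2)%N exprM.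
by rewrite lerXn2r // nnegrE ?exprn_ge0 //; lra.
Qed.

Lemma rad1_bounded a C : (forall n, `|a n| <= C) -> rad1 a.
Proof.
move=> aC r /andP[r0 r1]; exists C => n.
have C0 : 0 <= C := le_trans (normr_ge0 _) (aC 0%N).
rewrite -[C]mulr1; apply: ler_pM => //; first by rewrite exprn_ge0 // ltW.
by rewrite exprn_ile1 // ltW.
Qed.

Lemma le_sqr_between r : 0 < r < 1 -> exists2 s, 0 < s < 1 & r <= s ^+ 2.
Proof.
move=> /andP[r0 r1].
by exists ((1 + r) / 2); [apply/andP; split; lra|nra].
Qed.

Lemma rad1_mulS a : rad1 a -> rad1 (fun n => n.+1%:R * a n).
Proof.
move=> ha r r01; have [s s01 rs] := le_sqr_between r01.
have [C aC] := ha _ s01; exists ((1 - s)^-1 * C) => n.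
have /andP[r0 r1] := r01; have /andP[s0 s1] := s01.
have h : r ^+ n <= s ^+ n * s ^+ n.
  by rewrite -exprD addnn -muln2 mulnC exprM lerXn2r // nnegrE ?exprn_ge0 // ltW.
rewrite normrM normr_nat.
apply: le_trans (_ : (n.+1%:R * s ^+ n) * (`|a n| * s ^+ n) <= _).
  have -> : n.+1%:R * s ^+ n * (`|a n| * s ^+ n) = n.+1%:R * `|a n| * (s ^+ n * s ^+ n) by ring.
  by rewrite ler_wpM2l ?mulr_ge0.
apply: ler_pM (mulnX_bounded n s01) (aC n); rewrite ?mulr_ge0 ?exprn_ge0 //; exact: ltW.
Qed.

Lemma rad1_shift a : rad1 a -> rad1 (fun n => a n.+1).
Proof.
move=> ha r r01; have [C aC] := ha r r01; exists (C / r) => n.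
have /andP[r0 r1] := r01.
by rewrite ler_pdivlMr // -mulrA -exprSr.
Qed.

Lemma rad1_diffs a : rad1 a -> rad1 (pseries_diffs a).
Proof.
move=> ha; apply: rad1_mulS (fun n => a n.+1) _; exact: rad1_shift.
Qed.

Lemma rad1D a b : rad1 a -> rad1 b -> rad1 (fun n => a n + b n).
Proof.
move=> ha hb r r01; have [C aC] := ha r r01; have [D bD] := hb r r01.
have /andP[/ltW r0 r1] := r01.
exists (C + D) => n; apply: le_trans (lerD (aC n) (bD n)).
by rewrite -mulrDl ler_wpM2r ?exprn_ge0 // ler_normD.
Qed.

Lemma rad1Z c a : rad1 a -> rad1 (fun n => c * a n).
Proof.
move=> ha r r01; have [C aC] := ha r r01; exists (`|c| * C) => n.
by rewrite normrM -mulrA ler_wpM2l.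
Qed.

Lemma rad1_conv a b : rad1 a -> rad1 b -> rad1 (conv a b).
Proof.
move=> ha hb r r01; have [s s01 rs] := le_sqr_between r01.
have [A aA] := ha _ s01; have [B bB] := hb _ s01.
have /andP[/ltW r0 r1] := r01; have /andP[/ltW s0 s1] := s01.
exists (A * B * (1 - s)^-1) => n.
have h : r ^+ n <= s ^+ n * s ^+ n.
  by rewrite -exprD addnn -muln2 mulnC exprM lerXn2r // nnegrE ?exprn_ge0.
apply: le_trans (_ : `|conv a b n| * s ^+ n * s ^+ n <= _).
  by rewrite -mulrA ler_wpM2l.
have hc : `|conv a b n| * s ^+ n <= A * B * n.+1%:R.
  apply: le_trans (ler_wpM2r (exprn_ge0 _ s0) (ler_norm_sum _ _ _)) _.
  rewrite mulr_suml -[X in _ * X%:R](card_ord n.+1) -sumr_const mulr_sumr.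
  apply: ler_sum => k _; rewrite mulr1.
  have kn : (k <= n)%N by rewrite -ltnS.
  have -> : s ^+ n = s ^+ k * s ^+ (n - k) by rewrite -exprD subnKC.
  rewrite normrM mulrACA.
  by apply: ler_pM => //; rewrite mulr_ge0 // exprn_ge0.
apply: le_trans (ler_wpM2r (exprn_ge0 n s0) hc) _.
rewrite -[A * B * n.+1%:R * _]mulrA; apply: ler_wpM2l; last exact: mulnX_bounded.
apply: mulr_ge0; [apply: le_trans (aA 0%N)|apply: le_trans (bB 0%N)];
  by rewrite mulr_ge0 // exprn_ge0.
Qed.

Lemma pseries_bound a z r : rad1 a -> 0 < r < 1 -> `|z| <= r ^+ 4 ->
  exists2 C, 0 <= C & forall n, `|a n * z ^+ n| <= C * (r ^+ n) ^+ 3.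
Proof.
move=> ha r01 zr; have [C aC] := ha _ r01; have /andP[/ltW r0 _] := r01.
exists C => [|n]; first by apply: le_trans (aC 0%N); rewrite mulr_ge0 // exprn_ge0.
rewrite normrM normrX.
apply: le_trans (_ : `|a n| * (r ^+ n) ^+ 4 <= _).
  by rewrite ler_wpM2l // -exprM mulnC exprM lerXn2r // nnegrE exprn_ge0.
by rewrite exprS mulrA ler_wpM2r // !exprn_ge0.
Qed.

Lemma is_cvg_gf a z : rad1 a -> `|z| < 1 -> cvgn (pseries a z).
Proof.
move=> ha z1; have [r r01 zr] := le_expr4_between z1; have /andP[r0 r1] := r01.
have [C C0 aC] := pseries_bound ha r01 zr.
have r3 : 0 <= r ^+ 3 by rewrite exprn_ge0 // ltW.
apply: normed_cvg; apply: (@series_le_cvg _ _ (geometric C (r ^+ 3))) => [n|n|n|].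
- exact: normr_ge0.
- by rewrite /= mulr_ge0 // exprn_ge0.
- by rewrite /= -exprM mulnC exprM; exact: aC.
- by apply: is_cvg_geometric_series; rewrite ger0_norm // exprn_ilt1 // ltW.
Qed.

Lemma gf_is_derive a z : rad1 a -> `|z| < 1 ->
  is_derive z (1 : R) (gf a) (gf (pseries_diffs a) z).
Proof.
move=> ha z1; pose K := (1 + `|z|) / 2.
have z0 := normr_ge0 z.
have K0 : 0 <= K by rewrite /K; lra.
have K1' : K < 1 by rewrite /K; lra.
have K1 : `|K| < 1 by rewrite ger0_norm.
have zK : `|z| < `|K| by rewrite (ger0_norm K0) /K; lra.
have h1 := rad1_diffs ha; have h2 := rad1_diffs h1.
by apply: (@pseries_snd_diffs _ a K); [exact: is_cvg_gf..|].
Qed.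

Lemma gfD a b z : rad1 a -> rad1 b -> `|z| < 1 ->
  gf (fun n => a n + b n) z = gf a z + gf b z.
Proof.
move=> ha hb z1; rewrite /gf -lim_seriesD; [|exact: is_cvg_gf..].
congr (limn (series _)); apply/funext => n /=; exact: mulrDl.
Qed.

Lemma gfZ c a z : rad1 a -> `|z| < 1 -> gf (fun n => c * a n) z = c * gf a z.
Proof.
move=> ha z1; apply: cvg_lim => //.
rewrite (_ : pseries (fun n => c * a n) z = (fun n => c * pseries a z n)).
  by apply: cvgM; [exact: cvg_cst|exact: is_cvg_gf].
apply/funext => n /=.
by rewrite /pseries /series /= mulr_sumr; apply: eq_bigr => k _; rewrite mulrA.
Qed.

Lemma eq_gf a b z : a =1 b -> gf a z = gf b z.
Proof. by move=> /funext ->. Qed.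

Lemma gf_at0 a : gf a 0 = a 0%N.
Proof.
apply: cvg_lim => //; apply: cvg_near_cst; near=> n.
have n0 : (0 < n)%N by near: n; exact: nbhs_infty_gt.
rewrite /pseries /series /= big_mkord -(prednK n0) big_ord_recl expr0 mulr1.
by rewrite big1 ?addr0 // => k _; rewrite /= exprS mul0r mulr0.
Unshelve. all: end_near. Qed.

Lemma gf_cst1 z : `|z| < 1 -> gf (fun=> 1) z = (1 - z)^-1.
Proof.
move=> z1; rewrite -[RHS]mul1r; apply: cvg_lim => //; exact: cvg_geometric_series.
Qed.

Lemma sum_triangle (F : nat -> nat -> R) n :
  \sum_(m < n) \sum_(k < m.+1) F k (m - k)%N = \sum_(i < n) \sum_(j < n - i) F i j.
Proof.
elim: n => [|n IH]; first by rewrite !big_ord0.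
rewrite big_ord_recr /= {}IH [RHS]big_ord_recr /= [in RHS]subSn // subnn big_ord1.
rewrite [X in _ + X]big_ord_recr /= subnn addrA -big_split /=; congr (_ + _).
by apply: eq_bigr => i _; rewrite subSn 1?ltnW // big_ord_recr.
Qed.

Lemma gfM a b z : rad1 a -> rad1 b -> `|z| < 1 ->
  gf (conv a b) z = gf a z * gf b z.
Proof.
move=> ha hb z1; have [r r01 zr] := le_expr4_between z1; have /andP[r0 r1] := r01.
have [A A0 aA] := pseries_bound ha r01 zr.
have [B B0 bB] := pseries_bound hb r01 zr.
pose sa := pseries a z; pose sb := pseries b z; pose sc := pseries (conv a b) z.
have r0n n : 0 <= r ^+ n by rewrite exprn_ge0 // ltW.
(* The difference consists of the products with [i, j < n] and [i + j >= n]: at most [n ^ 2] of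
   them, each at most [A * B * (r ^+ n) ^+ 3]. *)
have tail n : `|sa n * sb n - sc n| <= A * B * (1 - r)^-1 ^+ 2 * r ^+ n.
  have -> : sc n = \sum_(i < n) \sum_(j < n - i) (a i * z ^+ i) * (b j * z ^+ j).
    rewrite -(sum_triangle (fun i j => (a i * z ^+ i) * (b j * z ^+ j))).
    rewrite /sc /pseries /series /= big_mkord; apply: eq_bigr => m _.
    rewrite mulr_suml; apply: eq_bigr => k _.
    have km : (k <= m)%N by rewrite -ltnS.
    by rewrite mulrACA -exprD subnKC.
  rewrite /sa /sb /pseries /series /= !big_mkord mulr_suml -sumrB.
  apply: le_trans (ler_norm_sum _ _ _) _.
  apply: le_trans (_ : \sum_(i < n) A * B * n%:R * (r ^+ n) ^+ 3 <= _).
    apply: ler_sum => i _; rewrite -mulr_sumr -mulrBr normrM.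
    have in_ : (n - i <= n)%N by rewrite leq_subr.
    rewrite (_ : \sum_(j < n) b j * z ^+ j = \sum_(0 <= j < n) b j * z ^+ j); last first.
      by rewrite big_mkord.
    rewrite -(big_mkord xpredT (fun j => b j * z ^+ j)).
    rewrite (big_cat_nat (leq0n _) in_) /= [_ + _ - _]addrAC subrr add0r.
    apply: le_trans (ler_wpM2l (normr_ge0 _) (ler_norm_sum _ _ _)) _.
    have -> : A * B * n%:R * (r ^+ n) ^+ 3 =
        A * (r ^+ i) ^+ 3 * (n%:R * (B * (r ^+ (n - i)) ^+ 3)).
      have -> : r ^+ n = r ^+ i * r ^+ (n - i) by rewrite -exprD subnKC // ltnW.
      by ring.
    apply: ler_pM => //; first by rewrite sumr_ge0.
    apply: le_trans (_ : \sum_(n - i <= j < n) B * (r ^+ (n - i)) ^+ 3 <= _).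
      rewrite big_nat [leRHS]big_nat; apply: ler_sum => j /andP[nij _].
      apply: le_trans (bB j) _; apply: ler_wpM2l => //.
      by rewrite lerXn2r ?nnegrE // ler_wiXn2l // ltW.
    rewrite big_const_nat iter_addr_0 -[leLHS]mulr_natl; apply: ler_wpM2r.
      by rewrite mulr_ge0 // exprn_ge0.
    by rewrite ler_nat leq_subr.
  rewrite sumr_const card_ord -[leLHS]mulr_natl.
  have nb : n%:R * r ^+ n <= (1 - r)^-1.
    by apply: le_trans (mulnX_bounded n r01); rewrite ler_wpM2r // ler_nat.
  have -> : n%:R * (A * B * n%:R * (r ^+ n) ^+ 3) =
     A * B * (n%:R * r ^+ n) ^+ 2 * r ^+ n by ring.
  rewrite ler_wpM2r // ler_wpM2l ?mulr_ge0 // lerXn2r // nnegrE ?mulr_ge0 //.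
  by rewrite invr_ge0 subr_ge0 ltW.
have ca : sa @ \oo --> gf a z by exact: is_cvg_gf.
have cb : sb @ \oo --> gf b z by exact: is_cvg_gf.
have cc : sc @ \oo --> gf (conv a b) z by apply: is_cvg_gf => //; exact: rad1_conv.
have lim0 : (fun n => sa n * sb n - sc n) @ \oo --> (0 : R).
  have h0 : (fun n => A * B * (1 - r)^-1 ^+ 2 * r ^+ n) @ \oo --> (0 : R).
    by apply: cvg_geometric; rewrite ger0_norm // ltW.
  apply: (squeeze_cvgr _ _ h0); last by rewrite -oppr0; exact: cvgN h0.
  by near=> n; rewrite -ler_norml; exact: tail.
have lim1 : (fun n => sa n * sb n - sc n) @ \oo --> gf a z * gf b z - gf (conv a b) z.
  by apply: cvgB cc; exact: cvgM.
have E := cvg_unique (@Rhausdorff R) lim0 lim1.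
by apply/esym/eqP; rewrite -subr_eq0 -E.
Unshelve. all: end_near. Qed.

Lemma gf_sum a z : rad1 a -> `|z| < 1 ->
  gf (fun n => \sum_(k < n.+1) a k) z = gf a z / (1 - z).
Proof.
move=> ha z1; rewrite -gf_cst1 // -gfM //; last first.
  by apply: (@rad1_bounded _ 1) => n; rewrite normr1.
by apply: eq_gf => n; apply: eq_bigr => k _; rewrite mulr1.
Qed.

Lemma rad1_cst c : rad1 (fun=> c).
Proof. by apply: (@rad1_bounded _ `|c|). Qed.

Lemma rad1_sum a : rad1 a -> rad1 (fun n => \sum_(k < n.+1) a k).
Proof.
move=> ha; have -> : (fun n => \sum_(k < n.+1) a k) = conv a (fun=> 1).
  by apply/funext => n; apply: eq_bigr => k _; rewrite mulr1.
exact: rad1_conv (rad1_cst _).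
Qed.

Lemma gf_linear z : `|z| < 1 -> gf (fun n => n.+1%:R) z = (1 - z)^-1 ^+ 2.
Proof.
move=> z1; rewrite expr2.
have := gf_sum (rad1_cst 1) z1; rewrite gf_cst1 // => <-.
by apply: eq_gf => n; rewrite sumr_const card_ord.
Qed.

Lemma gf_norm_le a C z : (forall n, `|a n| <= C) -> 0 <= z < 1 ->
  `|gf a z| <= C / (1 - z).
Proof.
move=> aC /andP[z0 z1].
have nz1 : `|z| < 1 by rewrite ger0_norm.
have ha := rad1_bounded aC.
rewrite -gf_cst1 // -gfZ //; last exact: rad1_cst.
have C0 : 0 <= C := le_trans (normr_ge0 _) (aC 0%N).
have le1 n : `|pseries a z n| <= pseries (fun=> C * 1) z n.
  rewrite /pseries /series /=; apply: le_trans (ler_norm_sum _ _ _) (ler_sum _ _) => k _.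
  by rewrite normrM normrX (ger0_norm z0) mulr1 ler_wpM2r // exprn_ge0.
have cC : cvgn (pseries (fun=> C * 1) z) by apply: is_cvg_gf => //; exact: rad1_cst.
have ca := is_cvg_gf ha nz1.
rewrite -lim_norm //; apply: ler_lim => //; first exact: is_cvg_norm.
by near=> n; exact: le1.
Unshelve. all: end_near. Qed.

Lemma gf_ge_head a z : rad1 a -> (forall n, 0 <= a n) -> 0 <= z < 1 -> a 0%N <= gf a z.
Proof.
move=> ha a0 /andP[z0 z1].
have nz1 : `|z| < 1 by rewrite ger0_norm.
apply: limr_ge; first exact: is_cvg_gf.
near=> n.
have n0 : (0 < n)%N by near: n; exact: nbhs_infty_gt.
rewrite /pseries /series /= big_mkord -(prednK n0) big_ord_recl expr0 mulr1.
by rewrite lerDl sumr_ge0 // => k _; rewrite mulr_ge0 // exprn_ge0.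
Unshelve. all: end_near. Qed.

(** The linear part contributes exactly [K], and a remainder bounded by [C] has generating function
    at most [C / (1 - z)]. *)
Lemma gf_abel a K C z : (forall n, `|a n - K * n.+1%:R| <= C) -> 0 <= z < 1 ->
  `|(1 - z) ^+ 2 * gf a z - K| <= C * (1 - z).
Proof.
move=> aC z01; have /andP[z0 z1] := z01.
have nz1 : `|z| < 1 by rewrite ger0_norm.
have v0 : 0 < 1 - z by rewrite subr_gt0.
have hl : rad1 (fun n => K * n.+1%:R).
  apply: rad1Z; have := rad1_mulS (rad1_cst 1).
  by congr rad1; apply/funext => n; rewrite mulr1.
have hd := rad1_bounded aC.
have -> : gf a z = gf (fun n => a n - K * n.+1%:R) z + K * (1 - z)^-1 ^+ 2.
  rewrite -gf_linear // -gfZ //; last first.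
    have := rad1_mulS (rad1_cst 1).
    by congr rad1; apply/funext => n; rewrite mulr1.
  by rewrite -gfD //; apply: eq_gf => n; rewrite subrK.
set g := gf _ z.
have -> : (1 - z) ^+ 2 * (g + K * (1 - z)^-1 ^+ 2) - K = (1 - z) ^+ 2 * g.
  by field; rewrite gt_eqF.
rewrite normrM ger0_norm ?exprn_ge0 ?(ltW v0) // expr2 -mulrA mulrC ler_pM2r //.
rewrite mulrC -ler_pdivlMr //; exact: gf_norm_le.
Qed.

End power_series.

(** * Improper integrals on [0, 1) *)

Section derivatives.
Variable R : realType.
Implicit Types (f g : R -> R) (x df dg a : R).

Local Notation der f x d := (is_derive (x : R) (1 : R) (f : R -> R) (d : R)).

Lemma der_eq f x df dg : der f x df -> df = dg -> der f x dg.
Proof. by move=> h <-. Qed.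

Lemma derC a x : der (fun=> a) x 0.
Proof. exact: is_derive_cst. Qed.

Lemma derX x : der (fun y => y) x 1.
Proof. exact: is_derive_id. Qed.

Lemma derD f g x df dg : der f x df -> der g x dg -> der (fun y => f y + g y) x (df + dg).
Proof. by move=> hf hg; exact: is_deriveD. Qed.

Lemma derN f x df : der f x df -> der (fun y => - f y) x (- df).
Proof. by move=> hf; exact: is_deriveN. Qed.

Lemma derM f g x df dg : der f x df -> der g x dg ->
  der (fun y => f y * g y) x (df * g x + f x * dg).
Proof.
move=> hf hg; apply: (der_eq (is_deriveM hf hg)).
by rewrite addrC; congr (_ + _); exact: mulrC.
Qed.

Lemma derV f x df : der f x df -> f x != 0 -> der (fun y => (f y)^-1) x (- df / f x ^+ 2).
Proof.
move=> hf f0; apply: (der_eq (is_deriveV f0 hf)).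
by rewrite mulNr; apply: (etrans (mulNr _ _)); rewrite mulrC.
Qed.

Lemma der_ln f x df : der f x df -> 0 < f x -> der (fun y => ln (f y)) x (df / f x).
Proof.
move=> hf f0; apply: (der_eq (is_derive1_comp (is_derive1_ln f0) hf)).
exact: mulrC.
Qed.

Lemma der_cvg f x df : der f x df -> f y @[y --> x] --> f x.
Proof. by move=> [/derivable1_diffP/differentiable_continuous]. Qed.

Lemma der_continuous_within f (df : R -> R) a b : 0 <= a -> b < 1 ->
  (forall x, 0 <= x < 1 -> der f x (df x)) -> {within `[a, b], continuous f}.
Proof.
move=> a0 b1 hf; apply: continuous_in_subspaceT => x; rewrite inE /= in_itv /= => /andP[ax xb].
apply: (@der_cvg _ _ (df x)); apply: hf.
by rewrite (le_trans a0 ax) (le_lt_trans xb b1).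
Qed.

Lemma mvt01 f (df : R -> R) a b : (forall x, 0 <= x < 1 -> der f x (df x)) ->
  0 <= a -> a <= b -> b < 1 -> exists2 x, a <= x <= b & f b - f a = df x * (b - a).
Proof.
move=> hf a0 ab b1.
have [||x + E] := @MVT_segment R f df a b ab.
- move=> x; rewrite in_itv /= => /andP[ax xb]; apply: hf.
  by rewrite (le_trans a0 (ltW ax)) (lt_trans xb b1).
- exact: der_continuous_within hf.
by rewrite in_itv /= => xab; exists x.
Qed.

Lemma der_nondecreasing f (df : R -> R) a b : (forall x, 0 <= x < 1 -> der f x (df x)) ->
  (forall x, a <= x <= b -> 0 <= df x) -> 0 <= a -> a <= b -> b < 1 -> f a <= f b.
Proof.
move=> hf df0 a0 ab b1; have [x xab E] := mvt01 hf a0 ab b1.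
by rewrite -subr_ge0 E mulr_ge0 ?df0 ?subr_ge0.
Qed.

Lemma der0_cst f : (forall x, 0 <= x < 1 -> der f x 0) ->
  forall x, 0 <= x < 1 -> f x = f 0.
Proof.
move=> hf x /andP[x0 x1]; have [y _] := mvt01 (df := fun=> 0) hf (lexx 0) x0 x1.
by rewrite mul0r => /eqP; rewrite subr_eq0 => /eqP.
Qed.

(* Along these points [1 - ln (1 - x)] takes the values [n + 2]. *)
Definition cut n : R := 1 - expR (- n.+1%:R).

Lemma onem_cut n : 1 - cut n = expR (- n.+1%:R).
Proof. by rewrite /cut opprB addrC subrK. Qed.

Lemma cut01 n : 0 < cut n < 1.
Proof.
by rewrite /cut subr_gt0 expR_lt1 oppr_lt0 ltr0n /= ltrBlDr ltrDl expR_gt0.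
Qed.

Lemma cut_ge0lt1 n : 0 <= cut n < 1.
Proof. by have /andP[/ltW -> ->] := cut01 n. Qed.

Lemma cut_nondecreasing : nondecreasing_seq cut.
Proof.
by move=> m n mn; rewrite /cut lerB // ler_expR lerN2 ler_nat.
Qed.

Lemma invS_cvg0 : (n.+1%:R^-1 : R) @[n --> \oo] --> (0 : R).
Proof. exact: cvg_harmonic. Qed.

Lemma expRN_le n : expR (- n.+1%:R) <= n.+1%:R^-1 :> R.
Proof.
rewrite expRN lef_pV2 ?posrE ?expR_gt0 ?ltr0n //.
by apply: le_trans (expR_ge1Dx _); rewrite lerDr.
Qed.

Lemma cut_cvg1 : cut n @[n --> \oo] --> (1 : R).
Proof.
have h : (1 - n.+1%:R^-1 : R) @[n --> \oo] --> (1 : R).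
  by rewrite -[X in _ --> X]subr0; apply: cvgB invS_cvg0; exact: cvg_cst.
apply: (@squeeze_cvgr _ _ _ _ _ (fun=> 1) _ _ 1 h); last exact: cvg_cst.
near=> n.
by rewrite lerB ?expRN_le //= lerBlDr lerDl expR_ge0.
Unshelve. all: end_near. Qed.

Lemma cut_exceeds x : x < 1 -> \forall n \near \oo, x < cut n.
Proof. by move=> x1; exact: (cvgr_gt 1 cut_cvg1 x x1). Qed.

Lemma bigcup_cut : \bigcup_n `[0, cut n]%classic = `[0, 1[%classic.
Proof.
apply/seteqP; split => x /=.
  move=> [n _] /=; rewrite !in_itv /= => /andP[-> xn].
  by have /andP[_ h] := cut01 n; rewrite (le_lt_trans xn h).
rewrite in_itv /= => /andP[x0 x1].
have [n _ /(_ n (leqnn n)) /= h] := cut_exceeds x1.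
by exists n => //=; rewrite in_itv /= x0 ltW.
Qed.

Lemma integral_improper_ge0 f F (l : R) :
  (forall x, 0 <= x < 1 -> der F x (f x)) ->
  (forall x, 0 <= x < 1 -> f y @[y --> x] --> f x) ->
  (forall x, 0 <= x < 1 -> 0 <= f x) ->
  F (cut n) @[n --> \oo] --> l ->
  measurable_fun (`[0, 1[%classic : set R) f /\
  (\int[lebesgue_measure]_(x in `[0%R, 1%R[) (f x)%:E = (l - F 0)%:E)%E.
Proof.
move=> dF cf f0 Fl.
have sub01 n x : x \in `[0, cut n] -> 0 <= x < 1.
  rewrite in_itv /= => /andP[-> xn] /=.
  by have /andP[_ h] := cut01 n; exact: le_lt_trans h.
have cfn n : {within `[0, cut n], continuous f}.
  by apply: continuous_in_subspaceT => x; rewrite inE /= => /sub01; exact: cf.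
have mfn n : measurable_fun (`[0, cut n]%classic : set R) f.
  by apply: subspace_continuous_measurable_fun => //; exact: cfn.
have mf : measurable_fun (`[0, 1[%classic : set R) f.
  by rewrite -bigcup_cut; apply/measurable_fun_bigcup.
split => //.
have In n : (\int[lebesgue_measure]_(x in `[0%R, cut n]) (f x)%:E = (F (cut n) - F 0)%:E)%E.
  have /andP[c0 c1] := cut01 n.
  rewrite (@continuous_FTC2 _ f F 0 (cut n)) //.
    split.
    - move=> x; rewrite in_itv /= => /andP[x0 xn].
      by have [] : der F x (f x) by apply: dF; rewrite (ltW x0) (lt_trans xn c1).
    - by apply: cvg_at_right_filter; apply: (der_cvg (dF 0 _)); rewrite lexx ltr01.
    - by apply: cvg_at_left_filter; apply: (der_cvg (dF (cut n) _)); rewrite cut_ge0lt1.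
  move=> x; rewrite in_itv /= => /andP[x0 xn].
  have [_] : der F x (f x) by apply: dF; rewrite (ltW x0) (lt_trans xn c1).
  by rewrite derive1E.
have lim1 : (\int[lebesgue_measure]_(x in `[0%R, cut n]) (f x)%:E)%E @[n --> \oo] -->
    (\int[lebesgue_measure]_(x in `[0%R, 1%R[) (f x)%:E)%E.
  rewrite -bigcup_cut; apply: ge0_nondecreasing_set_cvg_integral => //.
  - move=> m n mn; apply/subsetPset => x /=; rewrite !in_itv /= => /andP[-> /=].
    by move=> h; exact: le_trans (cut_nondecreasing mn).
  - by move=> n; apply/measurable_EFinP; exact: mfn.
  - by move=> n x /= /sub01 h; rewrite lee_fin f0.
have lim2 : (\int[lebesgue_measure]_(x in `[0%R, cut n]) (f x)%:E)%E @[n --> \oo] -->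
    (l - F 0)%:E.
  rewrite (eq_cvg _ _ In); apply: cvg_EFin; first by near=> n.
  by apply: cvgB Fl _; exact: cvg_cst.
exact: (cvg_unique (@ereal_hausdorff R) lim1 lim2).
Unshelve. all: end_near. Qed.

(** Monotone convergence applies to [C - f >= 0], and constants are integrable on an interval of
    finite length. *)
Lemma integral_improper_le f F (l C : R) :
  (forall x, 0 <= x < 1 -> der F x (f x)) ->
  (forall x, 0 <= x < 1 -> f y @[y --> x] --> f x) ->
  (forall x, 0 <= x < 1 -> f x <= C) ->
  F (cut n) @[n --> \oo] --> l ->
  (@lebesgue_measure R).-integrable `[0, 1[ (EFin \o f) /\
  \int[lebesgue_measure]_(x in `[0, 1[) f x = l - F 0.
Proof.
move=> dF cf fC Fl.
have [] := @integral_improper_ge0 (fun x => C - f x) (fun x => C * x - F x) (C - l).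
- move=> x x01; apply: der_eq (derD (derM (derC C x) (derX x)) (derN (dF x x01))) _.
  by rewrite mul0r add0r mulr1.
- by move=> x x01; apply: cvgB (cf x x01); exact: cvg_cst.
- by move=> x x01; rewrite subr_ge0 fC.
- apply: cvgB Fl; rewrite -[X in _ --> X]mulr1; apply: cvgM cut_cvg1; exact: cvg_cst.
rewrite mulr0 sub0r opprK => mg Ig.
have ig : (@lebesgue_measure R).-integrable `[0, 1[ (EFin \o (fun x => C - f x)).
  apply/integrableP; split; first exact/measurable_EFinP.
  rewrite [X in (X < _)%E](_ : _ = (C - l + F 0)%:E) ?ltry // -Ig.
  apply: eq_integral => x; rewrite inE /= in_itv /= => x01.
  by rewrite ger0_norm // subr_ge0 fC.
have ic : (@lebesgue_measure R).-integrable `[0, 1[ (EFin \o (fun=> C)).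
  apply/integrableP; split; first exact/measurable_EFinP/measurable_cst.
  rewrite [X in (X < _)%E](_ : _ = (`|C|%:E * lebesgue_measure (`[0%R, 1%R[%classic : set R))%E).
    by rewrite lebesgue_measure_itv /= lte_fin ltr01 oppr0 adde0 mule1 ltry.
  by rewrite -integral_cst.
have fE : f = (fun x => C - (C - f x)) by apply/funext => x; rewrite opprB addrC subrK.
have if_ : (@lebesgue_measure R).-integrable `[0, 1[ (EFin \o f).
  by rewrite fE; apply: (integrableB _ ic ig).
split=> //.
rewrite {1}fE RintegralB //.
rewrite [X in _ - X]/Rintegral Ig /=.
have -> : \int[lebesgue_measure]_(x in `[0, 1[) C = C.
  rewrite /Rintegral.
  rewrite (_ : (\int[_]_(x in _) _)%E = (C%:E * lebesgue_measure (`[0%R, 1%R[%classic : set R))%E).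
    by rewrite lebesgue_measure_itv /= lte_fin ltr01 oppr0 adde0 mule1.
  by rewrite -integral_cst.
by ring.
Qed.

End derivatives.

(** * Generating functions of the moments *)

Section generating_functions.
Variable R : realType.
Local Notation der f x d := (is_derive (x : R) (1 : R) (f : R -> R) (d : R)).
Implicit Types (x z : R).

Lemma derSq (f : R -> R) x df : der f x df -> der (fun y => f y ^+ 2) x (2 * f x * df).
Proof. by move=> hf; apply: der_eq (derM hf hf) _; ring. Qed.

Definition ell x : R := 1 - ln (1 - x).

Lemma ell_ge1 x : 0 <= x < 1 -> 1 <= ell x.
Proof.
move=> /andP[x0 x1]; rewrite /ell lerBrDr gerDl ln_le0 //.
by rewrite gerBl.
Qed.

Lemma der_ell x : x < 1 -> der ell x (1 - x)^-1.
Proof.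
move=> x1; have v0 : 0 < 1 - x by rewrite subr_gt0.
apply: der_eq (derD (derC 1 x) (derN (der_ln (derD (derC 1 x) (derN (derX x))) v0))) _.
by rewrite add0r sub0r mulN1r opprK.
Qed.

Lemma der_lnell x : 0 <= x < 1 -> der (fun y => ln (ell y)) x ((1 - x)^-1 / ell x).
Proof.
move=> x01; have /andP[_ x1] := x01.
by apply: der_ln (der_ell x1) _; exact: lt_le_trans (ell_ge1 x01).
Qed.

Variables (c C K : R).
Hypothesis mean_bound : forall m, `|mean c m| <= 2.
Hypothesis mean_free_bound : forall m, `|mean_free c m| <= C.

Local Notation p := (@prob_free R).
Local Notation P := (gf p).
Local Notation Y := (gf (mean c)).
Local Notation Q := (gf (mean_free c)).
Local Notation V := (gf (msq c)).

Lemma rad1_p : rad1 p. Proof. exact: rad1_bounded (@norm_prob_free R). Qed.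
Lemma rad1_mean : rad1 (mean c). Proof. exact: rad1_bounded mean_bound. Qed.
Lemma rad1_mean_free : rad1 (mean_free c). Proof. exact: rad1_bounded mean_free_bound. Qed.
Hypothesis rad1_msq : rad1 (msq c).

Let norm_lt1 x : 0 <= x < 1 -> `|x| < 1.
Proof. by move=> /andP[x0 x1]; rewrite ger0_norm. Qed.

Lemma der_P x : 0 <= x < 1 -> der P x (P x / (1 - x) - P x ^+ 2).
Proof.
move=> /norm_lt1 x1; apply: der_eq (gf_is_derive rad1_p x1) _.
have rp := rad1_p; have rpp := rad1_conv rp rp; have rs := rad1_sum rp.
have rz := rad1Z (-1) rpp.
rewrite (eq_gf _ (b := fun n => \sum_(k < n.+1) p k + (-1) * conv p p n)).
  by rewrite (gfD rs rz x1) gfZ // gfM // gf_sum // mulN1r.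
move=> n; rewrite /pseries_diffs prob_free_rec mulN1r -(sum_rev p) -sumrB.
by apply: eq_bigr => k _; rewrite mulrBl mul1r.
Qed.

Lemma der_Y x : 0 <= x < 1 -> der Y x (2 * Y x / (1 - x) - 2 * P x ^+ 2).
Proof.
move=> /norm_lt1 x1; apply: der_eq (gf_is_derive rad1_mean x1) _.
have rp := rad1_p; have ry := rad1_mean.
have rpp := rad1_conv rp rp; have rs := rad1_sum ry.
have h1 := rad1Z 2 rs; have h2 := rad1Z (-2) rpp.
rewrite (eq_gf _ (b := fun n => 2 * (\sum_(k < n.+1) mean c k) + (-2) * conv p p n)).
  by rewrite (gfD h1 h2 x1) !gfZ // gfM // gf_sum //; ring.
by move=> n; rewrite /pseries_diffs mean_rec mulNr.
Qed.

Lemma der_Q x : 0 <= x < 1 -> der Q x (Q x / (1 - x) - 2 * (Q x * P x) + Y x * P x).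
Proof.
move=> /norm_lt1 x1; apply: der_eq (gf_is_derive rad1_mean_free x1) _.
have rp := rad1_p; have ry := rad1_mean; have rq := rad1_mean_free.
have rqp := rad1_conv rq rp; have rs := rad1_sum rq; have ryp := rad1_conv ry rp.
have h2 := rad1Z (-2) rqp; have h12 := rad1D rs h2.
rewrite (eq_gf _ (b := fun n => (\sum_(k < n.+1) mean_free c k +
    (-2) * conv (mean_free c) p n) + conv (mean c) p n)).
  by rewrite (gfD h12 ryp x1) (gfD rs h2 x1) gfZ // !gfM // gf_sum //; ring.
by move=> n; rewrite /pseries_diffs mean_free_rec mulNr.
Qed.

Lemma der_V x : 0 <= x < 1 ->
  der V x (2 * V x / (1 - x) + 2 * Y x ^+ 2 + 4 * P x ^+ 2 - 8 * (Q x * P x)).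
Proof.
move=> /norm_lt1 x1; apply: der_eq (gf_is_derive rad1_msq x1) _.
have rp := rad1_p; have ry := rad1_mean; have rq := rad1_mean_free.
have rqp := rad1_conv rq rp; have rs := rad1_sum rad1_msq.
have ryy := rad1_conv ry ry; have rpp := rad1_conv rp rp.
rewrite (eq_gf _ (b := fun n => 2 * (\sum_(k < n.+1) msq c k) +
   (2 * conv (mean c) (mean c) n + (4 * conv p p n + (-8) * conv (mean_free c) p n)))).
  have h3 := rad1Z 4 rpp; have h4 := rad1Z (-8) rqp; have h2 := rad1Z 2 ryy.
  have h34 := rad1D h3 h4; have h234 := rad1D h2 h34; have h1 := rad1Z 2 rs.
  rewrite (gfD h1 h234 x1) (gfD h2 h34 x1) (gfD h3 h4 x1) !gfZ // !gfM // gf_sum //.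
  by ring.
by move=> n; rewrite /pseries_diffs msq_rec /toll mulNr !addrA.
Qed.

(** The equation for [P] is of Bernoulli type: passing to [1 / P] makes it linear, and
    [1 / ((1 - x) P)] then has the derivative of [ell]. Division is safe since [P >= p 0 = 1]. *)
Lemma P_E x : 0 <= x < 1 -> P x = (1 - x)^-1 / ell x.
Proof.
move=> x01.
have P1 y : 0 <= y < 1 -> 1 <= P y.
  by move=> y01; rewrite -(prob_free0 R); apply: gf_ge_head => //; [exact: rad1_p|exact: prob_free_ge0].
pose f y := (P y)^-1 * (1 - y)^-1 - ell y.
have f0 : f 0 = 0.
  by rewrite /f gf_at0 prob_free0 /ell subr0 ln1 subr0 invr1 mulr1 subrr.
have fx : f x = 0.
  rewrite -f0; apply: der0_cst x01 => y y01; have /andP[y0 y1] := y01.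
  have v0 : 1 - y != 0 by rewrite gt_eqF // subr_gt0.
  have p0 : P y != 0 by rewrite gt_eqF // (lt_le_trans _ (P1 y y01)).
  apply: der_eq (derD (derM (derV (der_P y01) p0)
     (derV (derD (derC 1 y) (derN (derX y))) v0)) (derN (der_ell y1))) _.
  by field; rewrite v0 p0.
have p0 : P x != 0 by rewrite gt_eqF // (lt_le_trans _ (P1 x x01)).
have e0 : ell x != 0 by rewrite gt_eqF // (lt_le_trans _ (ell_ge1 x01)).
have v0 : 1 - x != 0 by move: x01 => /andP[_ x1]; rewrite gt_eqF // subr_gt0.
move/eqP: fx; rewrite /f subr_eq0 => /eqP <-.
by field; rewrite v0 p0.
Qed.

(* The solution of the equation for [Y] involves [A], the antiderivative of
   [1 / ell]; solving it for [A] defines [Ah] without integrating. *)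
Definition Ah x : R := ((1 - x) ^+ 2 * Y x + 1 + c) / 2 - (1 - x) / ell x.

Lemma Y_E x : 0 <= x < 1 -> Y x = (2 * (Ah x + (1 - x) / ell x) - 1 - c) / (1 - x) ^+ 2.
Proof.
move=> /andP[_ x1]; have v0 : 1 - x != 0 by rewrite gt_eqF // subr_gt0.
rewrite /Ah; move: (ell x)^-1 => e'.
by field.
Qed.

Lemma Ah0 : Ah 0 = 0.
Proof.
rewrite /Ah gf_at0 /mean E0 /cnul /= /ell subr0 ln1 subr0 expr1n divr1 mul1r mulr1.
by field.
Qed.

Lemma der_Ah x : 0 <= x < 1 -> der Ah x (ell x)^-1.
Proof.
move=> x01; have /andP[x0 x1] := x01.
have v0 : 1 - x != 0 by rewrite gt_eqF // subr_gt0.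
have e0 : ell x != 0 by rewrite gt_eqF // (lt_le_trans _ (ell_ge1 x01)).
have dv := derD (derC 1 x) (derN (derX x)).
apply: der_eq (derD (derM (derD (derD (derM (derSq dv) (der_Y x01)) (derC 1 x)) (derC c x))
  (derC 2^-1 x)) (derN (derM dv (derV (der_ell x1) e0)))) _.
rewrite (P_E x01); field.
by rewrite v0 e0.
Qed.

Local Notation G := ((1 + c) / 2).

(** The equation for [Q] has the integrating factor [(1 - x) * ell ^+ 2], and [kt] is the primitive
    of [ell * Y] whose value at 0 is [mean_free c 0 = 1 - c]. *)
Definition kt x : R := 2 * (Ah x - G) * (ell x - 1) / (1 - x) + 1 - c + 2 * ln (ell x).

Lemma Q_E x : 0 <= x < 1 -> Q x = kt x / ((1 - x) * ell x ^+ 2).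
Proof.
move=> x01; pose f y := Q y * ((1 - y) * ell y ^+ 2) - kt y.
have f0 : f 0 = 0.
  rewrite /f gf_at0 /kt /mean_free E0 /cnul /fr /= /ell subr0 ln1 subr0 ln1.
  by field.
have fx : f x = 0.
  rewrite -f0; apply: der0_cst x01 => y y01; have /andP[y0 y1] := y01.
  have v0 : 1 - y != 0 by rewrite gt_eqF // subr_gt0.
  have e0 : ell y != 0 by rewrite gt_eqF // (lt_le_trans _ (ell_ge1 y01)).
  have dv := derD (derC 1 y) (derN (derX y)).
  have de := der_ell y1.
  apply: der_eq (derD (derM (der_Q y01) (derM dv (derSq de)))
    (derN (derD (derD (derD (derM (derM (derM (derC 2 y) (derD (der_Ah y01) (derC (- G) y)))
       (derD de (derC (-1) y))) (derV dv v0)) (derC 1 y)) (derC (- c) y))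
       (derM (derC 2 y) (der_lnell y01))))) _.
  rewrite (P_E y01) (Y_E y01); field.
  by rewrite v0 e0.
have e0 : ell x != 0 by rewrite gt_eqF // (lt_le_trans _ (ell_ge1 x01)).
have v0 : 1 - x != 0 by move: x01 => /andP[_ x1]; rewrite gt_eqF // subr_gt0.
move/eqP: fx; rewrite /f subr_eq0 => /eqP <-.
by field; rewrite v0 e0.
Qed.

(* [Gm] and [K1h] are [Gminus] and [K1_integrand] with [Ah] in place of [A]. *)
Definition Gm x : R :=
  - ((2 * Ah x - 1) * ln (1 - x) / ((1 - x) * ell x)) + (ln (1 - x) + 2 * ln (ell x)) / ell x.

Definition K1h x : R :=
  (2 * Ah x - 1) ^+ 2 / (1 - x) ^+ 2 + 4 * Gm x / ell x - c ^+ 2 / (1 - x) ^+ 2.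

(* Decomposing a tree at its root instead of at the edge {1, 2} shows that
   [(1 - x) ^+ 2 * V - (1 - x) * J] has derivative [J] for
   [J = 4 * (Ah - G) ^+ 2 / (1 - x) ^+ 2
        + 4 * (Gm - c + c * x * ln (1 - x) / ((1 - x) * ell)) / ell],
   and [K1h - J] is [4 * c] times the derivative of
   [(Ah - G) / (1 - x) + x / ell - Ah]. *)
Definition K1_corr x : R :=
  4 * (Ah x - G) ^+ 2 / (1 - x) + 4 * (1 - x) * (Gm x - c) / ell x
  + 4 * c * x * ln (1 - x) / ell x ^+ 2 - 4 * c * (Ah x - G) / (1 - x)
  - 4 * c * x / ell x + 4 * c * Ah x.

Definition K1_prim x : R := (1 - x) ^+ 2 * V x - K1_corr x.

(** The same constant appears in the limit of [K1_prim] at 1, so the integral is exactly [K]. *)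
Lemma K1_prim0 : K1_prim 0 = - 4 * c * G.
Proof.
rewrite /K1_prim /K1_corr /Gm Ah0 gf_at0 /msq E0 /cnul /= /ell subr0 ln1 subr0 ln1.
by field.
Qed.

Lemma der_K1_prim x : 0 <= x < 1 -> der K1_prim x (K1h x).
Proof.
move=> x01; have /andP[x0 x1] := x01.
have v0 : 1 - x != 0 by rewrite gt_eqF // subr_gt0.
have e0 : ell x != 0 by rewrite gt_eqF // (lt_le_trans _ (ell_ge1 x01)).
have e20 : ell x ^+ 2 != 0 by rewrite expf_neq0.
have ve0 : (1 - x) * ell x != 0 by rewrite mulf_neq0.
have dx := derX x.
have dv := derD (derC 1 x) (derN (derX x)).
have de := der_ell x1.
have dl := der_ln dv (_ : 0 < 1 - x); rewrite subr_gt0 in dl; have {}dl := dl x1.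
have dle := der_lnell x01.
have da := der_Ah x01.
have daG := derD da (derC (- G) x).
have dGm := derD (derN (derM (derM (derD (derM (derC 2 x) da) (derC (-1) x)) dl)
   (derV (derM dv de) ve0)))
   (derM (derD dl (derM (derC 2 x) dle)) (derV de e0)).
have dW := derD (derD (derD (derD (derD
  (derM (derM (derC 4 x) (derSq daG)) (derV dv v0))
  (derM (derM (derM (derC 4 x) dv) (derD dGm (derC (- c) x))) (derV de e0)))
  (derM (derM (derM (derC (4 * c) x) dx) dl) (derV (derSq de) e20)))
  (derN (derM (derM (derC (4 * c) x) daG) (derV dv v0))))
  (derN (derM (derM (derC (4 * c) x) dx) (derV de e0))))
  (derM (derC (4 * c) x) da).
apply: der_eq (derD (derM (derSq dv) (der_V x01)) (derN dW)) _.
rewrite (P_E x01) (Y_E x01) (Q_E x01) /K1h /kt /Gm.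
(* Now both sides are rational in [x], [ell x], [ln (ell x)], [Ah x] and [V x], which can be treated
   as independent. *)
have -> : ln (1 - x) = 1 - ell x by rewrite /ell; ring.
move: (ell x) (ln (ell x)) (Ah x) (V x) v0 e0 => e le a vv v0 e0.
field.
by rewrite v0 e0.
Qed.

End generating_functions.

(** * Behaviour at 1 *)

Section boundary.
Variable R : realType.
Local Notation der f x d := (is_derive (x : R) (1 : R) (f : R -> R) (d : R)).
Implicit Types (x z : R).

Variables (c C K C' : R).
Hypothesis c_ge0 : 0 <= c.
Hypothesis mean_bound : forall m, `|mean c m| <= 2.
Hypothesis mean_free_bound : forall m, `|mean_free c m| <= C.
Hypothesis msq_bound : forall m, `|msq c m - K * m.+1%:R| <= C'.

Local Notation G := ((1 + c) / 2).
Local Notation Y := (gf (mean c)).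
Local Notation V := (gf (msq c)).
Local Notation Ah := (Ah c).

Let rad1_msq : rad1 (msq c).
Proof.
have -> : msq c = (fun m => (msq c m - K * m.+1%:R) + K * (m.+1%:R * 1)).
  by apply/funext => m; rewrite mulr1 subrK.
by apply: rad1D (rad1_bounded msq_bound) (rad1Z _ (rad1_mulS (rad1_cst 1))).
Qed.

Let dAh x : 0 <= x < 1 -> der Ah x (ell x)^-1.
Proof. exact: der_Ah. Qed.

Lemma ell_gt0 x : 0 <= x < 1 -> 0 < ell x.
Proof. by move=> /ell_ge1; exact: lt_le_trans. Qed.

Lemma ell_le x y : x <= y -> y < 1 -> ell x <= ell y.
Proof.
move=> xy y1; rewrite /ell lerB // ler_ln ?posrE ?subr_gt0 ?lerB //.
exact: le_lt_trans xy y1.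
Qed.

Lemma ell_cut n : ell (cut R n) = n.+2%:R.
Proof. by rewrite /ell onem_cut expRK opprK -[n.+2]addn1 natrD addrC. Qed.

Lemma le_lim_cut (f : R -> R) (l a x : R) : x < 1 -> f (cut R n) @[n --> \oo] --> l ->
  (forall y, x <= y < 1 -> a <= f y) -> a <= l.
Proof.
move=> x1 fl af; rewrite -(cvg_lim (@Rhausdorff R) fl).
apply: limr_ge; first by apply/cvg_ex; exists l.
near=> n; apply: af; have /andP[_ ->] := cut01 R n; rewrite andbT.
by apply: ltW; near: n; exact: cut_exceeds.
Unshelve. all: end_near. Qed.

Lemma inv_ell_cut : ((ell (cut R n))^-1 : R) @[n --> \oo] --> (0 : R).
Proof.
apply: (@squeeze_cvgr _ _ _ _ (fun=> 0) (fun n => n.+1%:R^-1)); last 2 first.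
- exact: cvg_cst.
- exact: invS_cvg0.
near=> n; rewrite ell_cut invr_ge0 ler0n /= lef_pV2 ?posrE ?ltr0n //.
by rewrite ler_nat.
Unshelve. all: end_near. Qed.

Lemma onem_cut_cvg0 : (1 - cut R n : R) @[n --> \oo] --> (0 : R).
Proof.
have -> : (0 : R) = 1 - 1 by rewrite subrr.
by apply: (cvgB _ (@cut_cvg1 R)); exact: cvg_cst.
Qed.

(** Bounded coefficients give [(1 - x) ^+ 2 * Y = O(1 - x)], so only the constant [(1 + c) / 2] of
    [Ah] survives. This ties [c] to the Gompertz constant. *)
Lemma Ah_cvg : Ah (cut R n) @[n --> \oo] --> G.
Proof.
have h1 : ((1 - cut R n) ^+ 2 * Y (cut R n) : R) @[n --> \oo] --> (0 : R).
  have h0 : 2 * (1 - cut R n : R) @[n --> \oo] --> (0 : R).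
    have -> : (0 : R) = 2 * 0 by rewrite mulr0.
    by apply: (cvgM _ onem_cut_cvg0); exact: cvg_cst.
  apply: (@squeeze_cvgr _ _ _ _ (fun n => - (2 * (1 - cut R n))) (fun n => 2 * (1 - cut R n))) => //.
    near=> n; rewrite -ler_norml.
    have := @gf_abel R (mean c) 0 2 (cut R n) _ (cut_ge0lt1 R n).
    by rewrite subr0; apply => m; rewrite mul0r subr0.
  by rewrite -oppr0; exact: cvgN.
have -> : G = (0 + 1 + c) * 2^-1 - 0 * 0 by ring.
apply: cvgB; last exact: (cvgM onem_cut_cvg0 inv_ell_cut).
by apply: (cvgM _ (cvg_cst _)); apply: (cvgD _ (cvg_cst _)); exact: (cvgD h1 (cvg_cst _)).
Unshelve. all: end_near. Qed.

Lemma Ah_le x : 0 <= x < 1 -> Ah x <= G.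
Proof.
move=> /andP[x0 x1]; apply: (le_lim_cut x1 Ah_cvg) => y /andP[xy y1].
apply: (der_nondecreasing dAh) => // z /andP[xz zy].
by rewrite invr_ge0 ltW // ell_gt0 // (le_trans x0 xz) (le_lt_trans zy y1).
Qed.

(** [G - Ah x] is the integral of the decreasing function [1 / ell] over the rest of [0, 1). *)
Lemma Ah_ge x : 0 <= x < 1 -> G - Ah x <= (1 - x) / ell x.
Proof.
move=> x01; have /andP[x0 x1] := x01.
have : 0 <= (1 - x) * (ell x)^-1 - (G - Ah x).
  pose g y := (y - x) * (ell x)^-1 - (Ah y - Ah x).
  apply: (@le_lim_cut g _ _ x x1) => [|y /andP[xy y1]].
    apply: cvgB; last exact: (cvgB Ah_cvg (cvg_cst _)).
    by apply: (cvgM _ (cvg_cst _)); exact: (cvgB (@cut_cvg1 R) (cvg_cst _)).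
  have gx0 : g x = 0 by rewrite /g !subrr mul0r subr0.
  suff : g x <= g y by rewrite gx0.
  apply: (@der_nondecreasing _ g (fun z => (ell x)^-1 - (ell z)^-1) x y _ _ x0 xy y1)
    => [z z01|z /andP[xz zy]].
    apply: der_eq (derD (derM (derD (derX z) (derC (- x) z)) (derC (ell x)^-1 z))
      (derN (derD (dAh z01) (derC (- Ah x) z)))) _.
    by ring.
  have z1 := le_lt_trans zy y1.
  by rewrite subr_ge0 lef_pV2 ?posrE ?ell_gt0 ?x01 ?(le_trans x0 xz) ?z1 // ell_le.
by rewrite subr_ge0.
Qed.

(* The remainder in [G - A(x) ~ (1 - x) (1 / ell - 1 / ell ^ 2)] is nonnegative. *)
Lemma Ah_le2 x : 0 <= x < 1 -> (1 - x) * (ell x - 1) / ell x ^+ 2 <= G - Ah x.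
Proof.
move=> x01; have /andP[x0 x1] := x01.
pose D y := Ah y + (1 - y) * ((ell y)^-1 - (ell y)^-1 ^+ 2).
have DG : D (cut R n) @[n --> \oo] --> G.
  have -> : G = G + 0 * (0 - 0 ^+ 2) by ring.
  apply: (cvgD Ah_cvg); apply: (cvgM onem_cut_cvg0).
  by apply: (cvgB inv_ell_cut); exact: (cvgM inv_ell_cut inv_ell_cut).
have : D x <= G.
  apply: (le_lim_cut x1 DG) => y /andP[xy y1].
  apply: (@der_nondecreasing _ D (fun z => 2 * (ell z)^-1 ^+ 3) x y _ _ x0 xy y1)
    => [z z01|z /andP[xz zy]].
    have e0 : ell z != 0 by rewrite gt_eqF // ell_gt0.
    have /andP[_ z1] := z01.
    have v0 : 1 - z != 0 by rewrite gt_eqF // subr_gt0.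
    have dV := derV (der_ell z1) e0.
    apply: der_eq (derD (dAh z01) (derM (derD (derC 1 z) (derN (derX z)))
       (derD dV (derN (derSq dV))))) _.
    by field; rewrite v0 e0.
  by rewrite mulr_ge0 // exprn_ge0 // invr_ge0 ltW // ell_gt0 // (le_trans x0 xz) (le_lt_trans zy y1).
rewrite /D addrC -lerBrDr; apply: le_trans.
rewrite le_eqVlt; apply/orP; left; apply/eqP.
by field; rewrite gt_eqF // ell_gt0.
Qed.

Lemma ln_ell_bounds x : 0 <= x < 1 -> 0 <= ln (ell x) <= ell x.
Proof.
move=> x01; rewrite ln_ge0 ?ell_ge1 //=.
exact: ltW (ln_sublinear (ell_gt0 x01)).
Qed.

(** With [s = (G - Ah) / (1 - x)] and [r = 1 / ell] the double pole cancels. The simple pole left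
    has coefficient [- 4 * c * (s - (1 - r) * r)], whose sign is settled by [c >= 0] and [Ah_le2].
    The other terms are at most 12 in total. *)
Lemma K1h_le x : 0 <= x < 1 -> K1h c x <= 20.
Proof.
move=> x01; have /andP[x0 x1] := x01.
have v0 : 0 < 1 - x by rewrite subr_gt0.
have e1 := ell_ge1 x01; have e0 := ell_gt0 x01.
have /andP[M0 Me] := ln_ell_bounds x01.
pose s := (G - Ah x) / (1 - x).
have s0 : 0 <= s by rewrite divr_ge0 ?subr_ge0 ?Ah_le // ltW.
have s1 : s <= (ell x)^-1.
  by rewrite ler_pdivrMr // [leRHS]mulrC; exact: Ah_ge.
have s2 : (ell x - 1) / ell x ^+ 2 <= s.
  by rewrite ler_pdivlMr // [leLHS]mulrC mulrA; exact: Ah_le2.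
pose r := (ell x)^-1.
have r0 : 0 <= r by rewrite invr_ge0 ltW.
have r1 : r <= 1 by rewrite invf_le1.
have Mr : ln (ell x) * r ^+ 2 <= 1.
  apply: le_trans (_ : ell x * r ^+ 2 <= 1); first by rewrite ler_wpM2r // exprn_ge0.
  by rewrite expr2 mulrA divff ?mul1r // gt_eqF.
have -> : K1h c x = 4 * s ^+ 2 - 4 * c * (s - (1 - r) * r) / (1 - x)
    - 8 * s * (1 - r) * r + 4 * (2 * (ln (ell x) * r ^+ 2) - (1 - r) * r).
  have lE : ln (1 - x) = 1 - ell x by rewrite /ell; ring.
  rewrite /K1h /Gm lE /s /r; field.
  by rewrite !gt_eqF.
have s2' : (1 - r) * r <= s.
  apply: le_trans s2; rewrite le_eqVlt; apply/orP; left; apply/eqP.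
  by rewrite /r; field; rewrite gt_eqF.
have t1 : 0 <= 4 * c * (s - (1 - r) * r) / (1 - x).
  by rewrite divr_ge0 ?(ltW v0) // mulr_ge0 ?mulr_ge0 ?subr_ge0.
have t2 : 0 <= (1 - r) * r by rewrite mulr_ge0 ?subr_ge0.
have t3 : 0 <= 8 * s * (1 - r) * r by rewrite -mulrA; apply: (mulr_ge0 _ t2); apply: mulr_ge0.
have t4 : s ^+ 2 <= 1 by rewrite exprn_ile1 // (le_trans s1).
set u1 := 4 * c * _ / _ in t1 *; set u3 := 8 * s * _ * _ in t3 *.
set u2 := (1 - r) * r in t2 *; set u5 := _ * r ^+ 2 in Mr *.
by clearbody u1 u2 u3 u5; lra.
Qed.

Lemma K1h_continuous x : 0 <= x < 1 -> K1h c y @[y --> x] --> K1h c x.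
Proof.
move=> x01; have /andP[x0 x1] := x01.
have v0 : 0 < 1 - x by rewrite subr_gt0.
have e0 : ell x != 0 by rewrite gt_eqF // ell_gt0.
have v1 : (1 - x) ^+ 2 != 0 by rewrite expf_neq0 // gt_eqF.
have ve0 : (1 - x) * ell x != 0 by rewrite mulf_neq0 // gt_eqF.
have dv := derD (derC 1 x) (derN (derX x)).
have de := der_ell x1; have dl := der_ln dv v0; have dle := der_lnell x01.
have da1 := derD (derM (derC 2 x) (dAh x01)) (derC (-1) x).
have dGm := derD (derN (derM (derM da1 dl) (derV (derM dv de) ve0)))
   (derM (derD dl (derM (derC 2 x) dle)) (derV de e0)).
have dV2 := derV (derSq dv) v1.
have d := derD (derD (derM (derSq da1) dV2) (derM (derM (derC 4 x) dGm) (derV de e0)))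
  (derN (derM (derC (c ^+ 2) x) dV2)).
exact: (der_cvg d).
Qed.

Let K1_corr_cvg (s v r mu a x : nat -> R) (a0 : R) :
  s n @[n --> \oo] --> (0 : R) -> v n @[n --> \oo] --> (0 : R) ->
  r n @[n --> \oo] --> (0 : R) -> mu n @[n --> \oo] --> (0 : R) ->
  a n @[n --> \oo] --> (a0 : R) -> x n @[n --> \oo] --> (1 : R) ->
  (4 * (s n * s n) * v n
    + (4 * (2 * a n - 1) * (1 - r n) * r n
       + 4 * v n * (2 * mu n - (1 - r n) * r n) - 4 * c * v n * r n)
    - 4 * c * x n * (1 - r n) * r n + 4 * c * s n - 4 * c * x n * r n
    + 4 * c * a n : R) @[n --> \oo] --> (4 * c * a0 : R).
Proof.
move=> sc vc rc muc ac xc.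
have -> : 4 * c * a0 = 4 * (0 * 0) * 0
    + (4 * (2 * a0 - 1) * (1 - 0) * 0 + 4 * 0 * (2 * 0 - (1 - 0) * 0) - 4 * c * 0 * 0)
    - 4 * c * 1 * (1 - 0) * 0 + 4 * c * 0 - 4 * c * 1 * 0 + 4 * c * a0 :> R by ring.
have k (b : R) : (fun _ : nat => b) n @[n --> \oo] --> b by exact: cvg_cst.
have q : (1 - r n : R) @[n --> \oo] --> (1 - 0 : R) by exact: (cvgB (k 1) rc).
have kc := k (4 * c).
have h2 : (4 * (2 * a n - 1) * (1 - r n) * r n : R) @[n --> \oo] -->
    (4 * (2 * a0 - 1) * (1 - 0) * 0 : R).
  exact: (cvgM (cvgM (cvgM (k 4) (cvgB (cvgM (k 2) ac) (k 1))) q) rc).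
have h3 : (4 * v n * (2 * mu n - (1 - r n) * r n) : R) @[n --> \oo] -->
    (4 * 0 * (2 * 0 - (1 - 0) * 0) : R).
  exact: (cvgM (cvgM (k 4) vc) (cvgB (cvgM (k 2) muc) (cvgM q rc))).
exact: (cvgD (cvgB (cvgD (cvgB (cvgD (cvgM (cvgM (k 4) (cvgM sc sc)) vc)
  (cvgB (cvgD h2 h3) (cvgM (cvgM kc vc) rc))) (cvgM (cvgM (cvgM kc xc) q) rc))
  (cvgM kc sc)) (cvgM (cvgM kc xc) rc)) (cvgM kc ac)).
Qed.

Lemma K1_prim_cvg : K1_prim c (cut R n) @[n --> \oo] --> (K - 4 * c * G : R).
Proof.
have Vc : ((1 - cut R n) ^+ 2 * V (cut R n) : R) @[n --> \oo] --> K.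
  have h0 : (C' * (1 - cut R n) : R) @[n --> \oo] --> (0 : R).
    have -> : (0 : R) = C' * 0 by rewrite mulr0.
    by apply: (cvgM _ onem_cut_cvg0); exact: cvg_cst.
  have h1 : ((1 - cut R n) ^+ 2 * V (cut R n) - K : R) @[n --> \oo] --> (0 : R).
    apply: (@squeeze_cvgr _ _ _ _ (fun n => - (C' * (1 - cut R n))) (fun n => C' * (1 - cut R n))) => //.
      near=> n1; rewrite -ler_norml.
      exact: (gf_abel msq_bound (cut_ge0lt1 R n1)).
    by rewrite -oppr0; exact: cvgN.
  rewrite -[X in _ --> X]add0r; apply: cvg_trans (cvgD h1 (cvg_cst K)).
  by apply: near_eq_cvg; near=> n2; rewrite /= subrK.
pose v n := 1 - cut R n; pose r n := (ell (cut R n))^-1.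
pose s n := (G - Ah (cut R n)) / v n.
pose mu n := ln (ell (cut R n)) * r n ^+ 2.
have c01 n := cut_ge0lt1 R n.
have v_gt0 n : 0 < v n by rewrite /v subr_gt0; have /andP[] := c01 n.
have sc : (s n : R) @[n --> \oo] --> (0 : R).
  apply: (@squeeze_cvgr _ _ _ _ (fun=> 0) r); last 2 first.
  - exact: cvg_cst.
  - exact: inv_ell_cut.
  near=> n3; rewrite divr_ge0 ?(ltW (v_gt0 n3)) ?subr_ge0 ?Ah_le //=.
  by rewrite ler_pdivrMr // [leRHS]mulrC; exact: Ah_ge.
have muc : (mu n : R) @[n --> \oo] --> (0 : R).
  apply: (@squeeze_cvgr _ _ _ _ (fun=> 0) r); last 2 first.
  - exact: cvg_cst.
  - exact: inv_ell_cut.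
  near=> n4; have /andP[M0 Me] := ln_ell_bounds (c01 n4); have e0 := ell_gt0 (c01 n4).
  rewrite mulr_ge0 ?exprn_ge0 ?invr_ge0 ?(ltW e0) //=.
  apply: le_trans (_ : ell (cut R n4) * r n4 ^+ 2 <= r n4).
    by rewrite ler_wpM2r // exprn_ge0 // invr_ge0 ltW.
  by rewrite expr2 mulrA divff ?mul1r // gt_eqF.
have WE n : K1_corr c (cut R n) = 4 * (s n * s n) * v n
    + (4 * (2 * Ah (cut R n) - 1) * (1 - r n) * r n
       + 4 * v n * (2 * mu n - (1 - r n) * r n) - 4 * c * v n * r n)
    - 4 * c * cut R n * (1 - r n) * r n + 4 * c * s n - 4 * c * cut R n * r n
    + 4 * c * Ah (cut R n).
  have lE : ln (1 - cut R n) = 1 - ell (cut R n) by rewrite /ell; ring.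
  have := v_gt0 n; have := ell_gt0 (c01 n).
  rewrite /K1_corr /Gm lE /s /mu /r /v => e0 v0; field.
  by rewrite !gt_eqF.
have Wc : (K1_corr c (cut R n) : R) @[n --> \oo] --> (4 * c * G : R).
  rewrite (funext WE).
  exact: (K1_corr_cvg sc onem_cut_cvg0 inv_ell_cut muc Ah_cvg (@cut_cvg1 R)).
exact: (cvgB Vc Wc).
Unshelve. all: end_near. Qed.

Lemma inv_ell_continuous x : 0 <= x < 1 -> (ell y)^-1 @[y --> x] --> (ell x)^-1.
Proof.
move=> x01; have e0 : ell x != 0 by rewrite gt_eqF // ell_gt0.
by have /andP[_ x1] := x01; exact: (der_cvg (derV (der_ell x1) e0)).
Qed.

Lemma A_E x : 0 <= x < 1 -> A x = Ah x.
Proof.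
move=> /andP[]; rewrite le_eqVlt => /predU1P[<- _|x0 x1].
  by rewrite /A set_itv1 Rintegral_set1 Ah0.
rewrite /A /Rintegral (@continuous_FTC2 _ _ Ah 0 x) //.
- by rewrite Ah0 /= subr0.
- apply: continuous_in_subspaceT => y; rewrite inE /= in_itv /= => /andP[y0 yx].
  by apply: inv_ell_continuous; rewrite y0 (le_lt_trans yx x1).
- split.
  + move=> y; rewrite in_itv /= => /andP[y0 yx].
    by have [] : der Ah y (ell y)^-1 by apply: dAh; rewrite (ltW y0) (lt_trans yx x1).
  + by apply: cvg_at_right_filter; apply: (der_cvg (dAh _)); rewrite lexx ltr01.
  + by apply: cvg_at_left_filter; apply: (der_cvg (dAh _)); rewrite (ltW x0) x1.
move=> y; rewrite in_itv /= => /andP[y0 yx].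
have [_] : der Ah y (ell y)^-1 by apply: dAh; rewrite (ltW y0) (lt_trans yx x1).
by rewrite derive1E.
Qed.

Lemma Gompertz_E : Gompertz R = G.
Proof.
have inv_ell_le1 x : 0 <= x < 1 -> (ell x)^-1 <= 1.
  by move=> x01; rewrite invf_le1 ?ell_gt0 ?ell_ge1.
have [intg E] := integral_improper_le dAh inv_ell_continuous inv_ell_le1 Ah_cvg.
(* Dropping the endpoint 1 discards the default value of the integrand there. *)
rewrite /Gompertz /A -Rintegral_itv_bndo_bndc; last exact: intg.
by rewrite E Ah0 subr0.
Qed.

Lemma K1_integrand_E x : 0 <= x < 1 -> K1_integrand x = K1h c x.
Proof.
move=> x01; rewrite /K1_integrand /K1h /Gminus /Gm A_E // Gompertz_E /ell.
by have -> : 2 * G - 1 = c by field.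
Qed.

Lemma integrable_K1_integrand :
  (@lebesgue_measure R).-integrable `[0, 1[ (EFin \o @K1_integrand R) /\ K1 R = K.
Proof.
have dH x : 0 <= x < 1 -> der (K1_prim c) x (K1h c x) by exact: der_K1_prim.
have [intK E] := integral_improper_le dH K1h_continuous K1h_le K1_prim_cvg.
have eqK x : x \in (`[0, 1[%classic : set R) -> K1h c x = K1_integrand x.
  by rewrite inE /= in_itv /= => x01; rewrite K1_integrand_E.
split.
  apply: eq_integrable intK => // x x01.
  by rewrite /= eqK.
have -> : K1 R = \int[lebesgue_measure]_(x in `[0, 1[) K1h c x.
  by apply: eq_Rintegral => x /eqK ->.
by rewrite E K1_prim0; ring.
Qed.

End boundary.

Theorem proposition4p4 (R : realType) :
  (@lebesgue_measure R).-integrable `[0, 1[ (EFin \o @K1_integrand R) /\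
  var_N0 R = (fun n : nat => K1 R * n%:R) +O_\oo (fun n : nat => n%:R / ln n%:R : R).
Proof.
have [c c_ge0 mean_bound] := bounded_mean R.
have [C mean_free_bound] := bounded_mean_free mean_bound.
have [K [C' msq_bound]] := msq_asymp mean_bound.
have [intK K1E] := integrable_K1_integrand c_ge0 mean_bound mean_free_bound msq_bound.
split => //; apply/eqaddOP; rewrite K1E.
have C'_ge0 : 0 <= C' := le_trans (normr_ge0 _) (msq_bound 0%N).
(* [C'] bounds the error of the second moment and 4 the squared mean; then [n / ln n >= 1] is
   enough. At [n = 1] the quotient takes the default value 0. *)
have bound n : (1 < n)%N -> `|var_N0 R n - K * n%:R| <= (C' + 4) * `|n%:R / ln n%:R|.
  case: n => [//|m] m0; rewrite (var_N0_msq m c).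
  have lnm : 0 < ln m.+1%:R :> R by rewrite ln_gt0 // ltr1n.
  have ge1 : 1 <= `|m.+1%:R / ln m.+1%:R| :> R.
    rewrite ger0_norm ?divr_ge0 ?(ltW lnm) // ler_pdivlMr // mul1r.
    by apply/ltW/ln_sublinear; rewrite ltr0n.
  apply: le_trans (_ : (C' + 4) * 1 <= _); last by rewrite ler_wpM2l // addr_ge0.
  have h1 := msq_bound m; have h2 := mean_bound m; rewrite mulr1.
  have h3 : mean c m ^+ 2 <= 4.
    rewrite -real_normK ?num_real // (_ : 4 = 2 ^+ 2 :> R); last by rewrite expr2; ring.
    by rewrite lerXn2r // nnegrE.
  have h4 := sqr_ge0 (mean c m).
  move: h1; rewrite !ler_norml => /andP[h1 h1'].
  by apply/andP; split; lra.
near=> k; near=> n.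
apply: le_trans (bound n _) _; first by near: n; exact: nbhs_infty_gt.
by rewrite ler_wpM2r //; near: k; exact: nbhs_pinfty_ge.
Unshelve. all: end_near. Qed.
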